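(* Let $S_{\underline\lambda}$ be a contractive weighted shift with positive weights on a directed tree $\mathcal{T}$, and suppose $S_{\underline\lambda}$ is of class $C_{1\cdot}$. (i) If $\mathcal{T}$ has a root, then $S_{\underline\lambda}^*$ is cyclic. (ii) If $\mathcal{T}$ is rootless and $\operatorname{Br}(\mathcal{T})<\infty$, then $S_{\underline\lambda}^*$ is cyclic.
   Context: A directed tree $\mathcal{T}=(V,E)$ is a connected directed graph without loops or directed circuits in which each vertex has at most one parent; $\operatorname{Chi}(u)=\{v:(u,v)\in E\}$; a root is a vertex without a parent; a leaf has no children; $\operatorname{Br}(\mathcal{T})=\sum_{u\text{ not a leaf}}(\#\operatorname{Chi}(u)-1)$. For weights $\lambda_v>0$ ($v$ not the root) with $\sup_u\sum_{v\in\operatorname{Chi}(u)}\lambda_v^2<\infty$, $S_{\underline\lambda}e_u=\sum_{v\in\operatorname{Chi}(u)}\lambda_ve_v$ on $\ell^2(V)$. A contraction $T$ is of class $C_{1\cdot}$ if $\|T^nx\|\not\to0$ for every $x\neq0$. An operator is cyclic if some vector's orbit has dense linear span. *)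

(* Defs.v *)
From Stdlib Require Import Reals List Relations ClassicalEpsilon.
Import ListNotations.
Open Scope R_scope.

Definition C := (R * R)%type.
Definition C0 : C := (0, 0).
Definition Cadd (z w : C) : C := (fst z + fst w, snd z + snd w).
Definition Copp (z : C) : C := (- fst z, - snd z).
Definition Cmul (z w : C) : C :=
  (fst z * fst w - snd z * snd w, fst z * snd w + snd z * fst w).
Definition Cscale (r : R) (z : C) : C := (r * fst z, r * snd z).
Definition Cnorm2 (z : C) : R := fst z * fst z + snd z * snd z.

Definition Rsum_list {V : Type} (f : V -> R) (L : list V) : R :=
  fold_right (fun v acc => f v + acc) 0 L.
Definition Csum_list {V : Type} (f : V -> C) (L : list V) : C :=
  fold_right (fun v acc => Cadd (f v) acc) C0 L.

(** Directed trees, given by a parent function [par] (each vertex has at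
    most one parent; [par v = None] iff [v] is a root). Edges: (u,v) with
    [par v = Some u]. *)
Fixpoint anc {V : Type} (par : V -> option V) (n : nat) (v : V) : option V :=
  match n with
  | O => Some v
  | S k => match anc par k v with Some w => par w | None => None end
  end.

Definition edge {V : Type} (par : V -> option V) (u v : V) : Prop := par v = Some u.

Definition is_directed_tree {V : Type} (par : V -> option V) : Prop :=
  (forall (n : nat) (v : V), anc par (S n) v <> Some v) /\
  (forall u v : V, clos_refl_sym_trans V (edge par) u v).

Definition has_root {V : Type} (par : V -> option V) : Prop :=
  exists r : V, par r = None.

Definition child_list {V : Type} (par : V -> option V) (u : V) (L : list V) : Prop :=
  NoDup L /\ forall v, In v L -> par v = Some u.

(** Br(T) < infinity: the (possibly infinite) sum over non-leaves u of
    (#Chi(u) - 1) is finite, i.e. bounded sup of its finite partial sums. *)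
Definition Br_finite {V : Type} (par : V -> option V) : Prop :=
  exists N : nat, forall (us : list V) (f : V -> list V),
    NoDup us -> (forall u, In u us -> child_list par u (f u)) ->
    (fold_right (fun u acc => (length (f u) - 1) + acc) 0%nat us <= N)%nat.

Definition admissible_weights {V : Type} (par : V -> option V) (lam : V -> R) : Prop :=
  (forall v, par v <> None -> 0 < lam v) /\
  (exists M : R, forall u L, child_list par u L -> Rsum_list (fun v => lam v * lam v) L <= M).

Definition norm2_le {V : Type} (x : V -> C) (c : R) : Prop :=
  forall L : list V, NoDup L -> Rsum_list (fun v => Cnorm2 (x v)) L <= c.
Definition in_l2 {V : Type} (x : V -> C) : Prop := exists c, norm2_le x c.
Definition norm2_lt {V : Type} (x : V -> C) (eps : R) : Prop :=
  exists d, d < eps /\ norm2_le x d.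

Definition vsub {V : Type} (x y : V -> C) : V -> C := fun v => Cadd (x v) (Copp (y v)).

(** The weighted shift: S e_u = sum_{v in Chi u} lam_v e_v,
    i.e. (S x)(v) = lam_v x(parent v), and 0 at a root. *)
Definition wshift {V : Type} (par : V -> option V) (lam : V -> R) (x : V -> C) : V -> C :=
  fun v => match par v with Some u => Cscale (lam v) (x u) | None => C0 end.

Definition has_sum_children {V : Type} (par : V -> option V) (u : V) (g : V -> C) (s : C) : Prop :=
  forall eps, 0 < eps -> exists L0, child_list par u L0 /\
    forall L, child_list par u L -> incl L0 L ->
      Cnorm2 (Cadd (Csum_list g L) (Copp s)) < eps.

Definition wshift_adj {V : Type} (par : V -> option V) (lam : V -> R) (y : V -> C) : V -> C :=
  fun u => epsilon (inhabits C0)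
             (fun s => has_sum_children par u (fun v => Cscale (lam v) (y v)) s).

Definition contractive {V : Type} (T : (V -> C) -> (V -> C)) : Prop :=
  forall x c, in_l2 x -> norm2_le x c -> norm2_le (T x) c.

Definition class_C1dot {V : Type} (T : (V -> C) -> (V -> C)) : Prop :=
  forall x, in_l2 x -> (exists v, x v <> C0) ->
    ~ (forall eps, 0 < eps -> exists N, forall n, (N <= n)%nat ->
         norm2_le (Nat.iter n T x) eps).

Fixpoint lincomb {V : Type} (T : (V -> C) -> (V -> C)) (cs : list C) (x : V -> C) : V -> C :=
  match cs with
  | [] => fun _ => C0
  | c :: cs' => fun v => Cadd (Cmul c (x v)) (lincomb T cs' (T x) v)
  end.

Definition cyclic {V : Type} (T : (V -> C) -> (V -> C)) : Prop :=
  exists x, in_l2 x /\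
    forall y, in_l2 y -> forall eps, 0 < eps ->
      exists cs : list C, norm2_lt (vsub (lincomb T cs x) y) eps.

(* Main.v *)
(** Let [T = S^*], so that [T e_v = lam_v e_(par v)]; since [S] is of class [C_1.],
    the tree has no leaves, and it is countable because [sum lam_v^2 <= 1] over
    each set of children.  Rescaling, [T] maps [gam_v e_v] to
    [gam_u e_u] with [u = par v].

    Let [f] be a vector with [p_k(T) f -> 0] for some polynomials with
    [p_k(0) = 1], and let [kap_v] be vectors with [T kap_v = kap_(par v)], each
    killed by a power of [T].  Put [x = f + sum_k eps_k kap_(w_k)], where
    [T^(n_k) kap_(w_k) = kap_(v_k)], [n_k] is so large that [T^(n_k)] kills the
    previous terms, [p_k] is chosen after [eps_k] with [|p_k(T) f| << eps_k], and
    [eps_(k+1), ...] are tiny with respect to [p_k].  Then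
    [p_k(T) T^(n_k) x / eps_k] is close to [p_k(T) kap_(v_k)], which is
    [kap_(v_k)] plus a combination of the [kap] of its ancestors; by induction
    on the nilpotency index the closed span of the orbit of [x] contains every
    [kap_v], and then [f].

    If there is a root, take [f = 0] and [kap_v = gam_v e_v].  Otherwise, as
    [Br < oo], some vertex has a single line of descendants; with its ancestors it
    forms a two-sided path, on which [gam] is bounded because [S] is of class
    [C_1.], so [T] restricted to the path is a quasi-affine image of the bilateral
    shift.  Take for [f] the image of the Fourier coefficients of
    [exp (-1/|1-z|^2)] and for [kap_v] the difference of [gam_v e_v] and the
    corresponding vector of the path in the same generation.

    For the bilateral shift put [W = 1/(1-z)], a limit of polynomials in the
    weighted sup norm.  On the circle [Re W = 1/2] and [|W|^2 = - z W^2], so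
    [(1 + (W-1)/s)^(s^2)] equals 1 at [z = 0] and is small against the
    weight, whereas [(1 - z W^2/n)^n] approximates the inverse of the weight
    [exp (-|W|^2)]; the latter yields [e_m - e_(m-1)] in the closed span, and
    averaging yields [e_m]. *)

From Stdlib Require Import Reals Lra Lia Psatz List ZArith Cantor Relations.
From Stdlib Require Import Classical ClassicalEpsilon FunctionalExtensionality FinFun.
From Coquelicot Require Import Coquelicot.
Require Import Defs.
Import ListNotations.
Open Scope R_scope.

(** * Real square-summable families *)

Definition vzero {V : Type} : V -> R := fun _ => 0.
Definition vadd {V : Type} (x y : V -> R) : V -> R := fun v => x v + y v.
Definition vscal {V : Type} (a : R) (x : V -> R) : V -> R := fun v => a * x v.
Definition vdiff {V : Type} (x y : V -> R) : V -> R := fun v => x v - y v.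

Ltac vext :=
  apply functional_extensionality; intro;
  unfold vdiff, vadd, vscal, vzero; try ring.

(** The norm occurs only through upper bounds on finite sums, so no supremum has to be formed. The
    bound is [r] rather than its square, which makes the triangle inequality additive. *)
Definition norm_le {V : Type} (x : V -> R) (r : R) : Prop :=
  0 <= r /\ forall L, NoDup L -> Rsum_list (fun v => x v * x v) L <= r * r.

Definition l2 {V : Type} (x : V -> R) : Prop := exists r, norm_le x r.

Section FiniteSums.
Context {V : Type}.
Implicit Types (f g : V -> R) (L : list V).

Lemma Rsum_list_ext f g L :
  (forall v, In v L -> f v = g v) -> Rsum_list f L = Rsum_list g L.
Proof.
  induction L as [|a L IH]; simpl; intros H; auto.
  rewrite (H a), IH; auto.
Qed.

Lemma Rsum_list_le f g L :
  (forall v, In v L -> f v <= g v) -> Rsum_list f L <= Rsum_list g L.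
Proof.
  induction L as [|a L IH]; simpl; intros H; [lra|].
  apply Rplus_le_compat; auto.
Qed.

Lemma Rsum_list_plus f g L :
  Rsum_list (fun v => f v + g v) L = Rsum_list f L + Rsum_list g L.
Proof. induction L as [|a L IH]; simpl; [ring|rewrite IH; ring]. Qed.

Lemma Rsum_list_scal c f L :
  Rsum_list (fun v => c * f v) L = c * Rsum_list f L.
Proof. induction L as [|a L IH]; simpl; [ring|rewrite IH; ring]. Qed.

Lemma Rsum_list_zero f L : (forall v, In v L -> f v = 0) -> Rsum_list f L = 0.
Proof.
  induction L as [|a L IH]; simpl; intros H; auto.
  rewrite (H a), IH; auto; ring.
Qed.

Lemma Rsum_list_nonneg f L :
  (forall v, In v L -> 0 <= f v) -> 0 <= Rsum_list f L.
Proof.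
  induction L as [|a L IH]; simpl; intros H; [lra|].
  apply Rplus_le_le_0_compat; auto.
Qed.

Lemma Rsum_list_app f L L' :
  Rsum_list f (L ++ L') = Rsum_list f L + Rsum_list f L'.
Proof. induction L as [|a L IH]; simpl; [ring|rewrite IH; ring]. Qed.

Lemma Rsum_list_split f L L' : NoDup L -> NoDup L' -> incl L L' ->
  exists L'', NoDup L'' /\ incl L'' L' /\
    Rsum_list f L' = Rsum_list f L + Rsum_list f L''.
Proof.
  revert L'; induction L as [|a L IH]; intros L' HL HL' Hi.
  - exists L'; simpl; repeat split; [auto|apply incl_refl|ring].
  - destruct (in_split a L' (Hi a (or_introl eq_refl))) as (l1 & l2 & ->).
    inversion_clear HL as [|? ? Ha HL1].
    destruct (IH (l1 ++ l2)) as (L'' & H1 & H2 & H3); auto.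
    + eapply NoDup_remove_1; eauto.
    + intros b Hb. specialize (Hi b (or_intror Hb)).
      apply in_app_or in Hi; apply in_or_app.
      destruct Hi as [Hi|[->|Hi]]; auto. contradiction.
    + exists L''; repeat split; auto.
      * intros b Hb. specialize (H2 b Hb).
        apply in_app_or in H2; apply in_or_app; simpl; tauto.
      * rewrite Rsum_list_app in *; simpl. lra.
Qed.

Lemma Rsum_list_incl_le f L L' :
  (forall v, In v L' -> 0 <= f v) -> NoDup L -> NoDup L' -> incl L L' ->
  Rsum_list f L <= Rsum_list f L'.
Proof.
  intros Hf HL HL' Hi.
  destruct (Rsum_list_split f L L' HL HL' Hi) as (L'' & _ & H2 & ->).
  assert (0 <= Rsum_list f L'') by (apply Rsum_list_nonneg; auto).
  lra.
Qed.

Lemma Rsum_list_single f L v0 : NoDup L -> In v0 L ->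
  (forall v, In v L -> v <> v0 -> f v = 0) -> Rsum_list f L = f v0.
Proof.
  intros HL Hin Hf.
  destruct (in_split v0 L Hin) as (l1 & l2 & ->).
  pose proof (NoDup_remove_2 _ _ _ HL) as Hn.
  rewrite Rsum_list_app; simpl.
  rewrite !Rsum_list_zero; [ring| |].
  - intros v Hv; apply Hf; [apply in_or_app; simpl; auto|].
    intros ->; apply Hn, in_or_app; auto.
  - intros v Hv; apply Hf; [apply in_or_app; simpl; auto|].
    intros ->; apply Hn, in_or_app; auto.
Qed.

(** The quadratic [A + 2 t B + t^2 D] in [t] is a sum of squares; it is tested at its minimum
    [t = - B / D]. *)
Lemma Cauchy_Schwarz_list f g L :
  Rsum_list (fun v => f v * g v) L * Rsum_list (fun v => f v * g v) L
  <= Rsum_list (fun v => f v * f v) L * Rsum_list (fun v => g v * g v) L.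
Proof.
  assert (Hq : forall t, 0 <= Rsum_list (fun v => f v * f v) L
     + 2 * t * Rsum_list (fun v => f v * g v) L
     + t * t * Rsum_list (fun v => g v * g v) L).
  { intros t. rewrite <- !Rsum_list_scal, <- !Rsum_list_plus.
    apply Rsum_list_nonneg; intros v _.
    replace (_ + _) with ((f v + t * g v) * (f v + t * g v)) by ring.
    apply Rle_0_sqr. }
  set (A := Rsum_list (fun v => f v * f v) L) in *.
  set (B := Rsum_list (fun v => f v * g v) L) in *.
  assert (HC : 0 <= Rsum_list (fun v => g v * g v) L)
    by (apply Rsum_list_nonneg; intros; apply Rle_0_sqr).
  set (D := Rsum_list (fun v => g v * g v) L) in *.
  destruct (Rle_lt_or_eq_dec _ _ HC) as [HD|HD].
  - specialize (Hq (- B / D)).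
    apply (Rmult_le_compat_r D) in Hq; [|lra].
    replace ((A + 2 * (- B / D) * B + - B / D * (- B / D) * D) * D)
      with (A * D - B * B) in Hq by (field; lra).
    lra.
  - rewrite <- HD in *.
    destruct (Req_dec B 0) as [->|HB]; [lra|].
    (* With [D = 0] the quadratic is affine in [t]; this [t] gives it the value [-1]. *)
    specialize (Hq (- (A + 1) / (2 * B))).
    replace (A + 2 * (- (A + 1) / (2 * B)) * B + - (A + 1) / (2 * B) * (- (A + 1) / (2 * B)) * 0)
      with (-1) in Hq by (field; auto).
    lra.
Qed.

End FiniteSums.

Section Norm.
Context {V : Type}.
Implicit Types (x y : V -> R).

Lemma norm_le_nonneg x r : norm_le x r -> 0 <= r.
Proof. intros [H _]; auto. Qed.

Lemma norm_le_zero : norm_le (@vzero V) 0.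
Proof.
  split; [lra|]; intros L _.
  rewrite Rsum_list_zero; [lra|]; intros; unfold vzero; ring.
Qed.

Lemma norm_le_weaken x r s : norm_le x r -> r <= s -> norm_le x s.
Proof.
  intros [H0 H] Hrs; split; [lra|].
  intros L HL; specialize (H L HL); nra.
Qed.

Lemma norm_le_add x y r s :
  norm_le x r -> norm_le y s -> norm_le (vadd x y) (r + s).
Proof.
  intros [H0 H] [K0 K]; split; [lra|].
  intros L HL; specialize (H L HL); specialize (K L HL).
  pose proof (Cauchy_Schwarz_list x y L) as HC.
  replace (Rsum_list (fun v => vadd x y v * vadd x y v) L)
    with (Rsum_list (fun v => x v * x v) L + 2 * Rsum_list (fun v => x v * y v) L
          + Rsum_list (fun v => y v * y v) L)
    by (rewrite <- !Rsum_list_scal, <- !Rsum_list_plus;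
        apply Rsum_list_ext; intros; unfold vadd; ring).
  assert (0 <= Rsum_list (fun v => x v * x v) L)
    by (apply Rsum_list_nonneg; intros; apply Rle_0_sqr).
  assert (0 <= Rsum_list (fun v => y v * y v) L)
    by (apply Rsum_list_nonneg; intros; apply Rle_0_sqr).
  set (B := Rsum_list (fun v => x v * y v) L) in *.
  assert (B * B <= (r * s) * (r * s)).
  { eapply Rle_trans; [apply HC|].
    replace (r * s * (r * s)) with ((r * r) * (s * s)) by ring.
    apply Rmult_le_compat; auto. }
  assert (0 <= r * s) by nra.
  assert (B <= r * s) by nra.
  nra.
Qed.

Lemma norm_le_scal a x r : norm_le x r -> norm_le (vscal a x) (Rabs a * r).
Proof.
  intros [H0 H]; split; [pose proof (Rabs_pos a); nra|].
  intros L HL; specialize (H L HL).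
  replace (Rsum_list _ L) with ((a * a) * Rsum_list (fun v => x v * x v) L)
    by (rewrite <- Rsum_list_scal; apply Rsum_list_ext; intros; unfold vscal; ring).
  replace (Rabs a * r * (Rabs a * r)) with ((Rabs a * Rabs a) * (r * r)) by ring.
  rewrite <- Rabs_mult, (Rabs_pos_eq (a * a)) by apply Rle_0_sqr.
  apply Rmult_le_compat_l; auto. apply Rle_0_sqr.
Qed.

Lemma norm_le_diff x y r s :
  norm_le x r -> norm_le y s -> norm_le (vdiff x y) (r + s).
Proof.
  intros Hx Hy.
  replace (vdiff x y) with (vadd x (vscal (-1) y)) by vext.
  apply norm_le_add; auto.
  replace s with (Rabs (-1) * s) by (rewrite Rabs_left by lra; ring).
  apply norm_le_scal; auto.
Qed.

Lemma norm_le_coord x r v : norm_le x r -> Rabs (x v) <= r.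
Proof.
  intros [H0 H].
  assert (Hv : NoDup [v]) by (repeat constructor; auto).
  specialize (H [v] Hv); simpl in H.
  rewrite <- (Rabs_pos_eq r) by auto.
  apply Rsqr_le_abs_0; unfold Rsqr; lra.
Qed.

Lemma l2_zero : l2 (@vzero V).
Proof. exists 0; apply norm_le_zero. Qed.

Lemma l2_add x y : l2 x -> l2 y -> l2 (vadd x y).
Proof. intros [r H] [s K]; exists (r + s); apply norm_le_add; auto. Qed.

Lemma l2_scal a x : l2 x -> l2 (vscal a x).
Proof. intros [r H]; eexists; apply norm_le_scal; eauto. Qed.

Lemma l2_diff x y : l2 x -> l2 y -> l2 (vdiff x y).
Proof. intros [r H] [s K]; exists (r + s); apply norm_le_diff; auto. Qed.

Lemma Rsum_list_sqr_lim (p : nat -> V -> R) x L :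
  (forall v, is_lim_seq (fun n => p n v) (x v)) ->
  is_lim_seq (fun n => Rsum_list (fun v => p n v * p n v) L)
             (Rsum_list (fun v => x v * x v) L).
Proof.
  intros H; induction L as [|a L IH]; simpl.
  - apply is_lim_seq_const.
  - apply is_lim_seq_plus'; auto. apply is_lim_seq_mult'; auto.
Qed.

Lemma norm_le_lim (p : nat -> V -> R) x r :
  (forall v, is_lim_seq (fun n => p n v) (x v)) ->
  (forall n, norm_le (p n) r) -> norm_le x r.
Proof.
  intros Hl Hp; split; [apply (norm_le_nonneg _ _ (Hp O))|].
  intros L HL.
  assert (Hle : Rbar_le (Rsum_list (fun v => x v * x v) L) (r * r)).
  { apply (is_lim_seq_le (fun n => Rsum_list (fun v => p n v * p n v) L) (fun _ => r * r)).
    - intros n; apply Hp; auto.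
    - apply Rsum_list_sqr_lim; auto.
    - apply is_lim_seq_const. }
  exact Hle.
Qed.

Lemma halving_pow (b : nat -> R) : (forall k, b (S k) <= b k / 2) ->
  forall k j, b (k + j)%nat <= b k * (1 / 2) ^ j.
Proof.
  intros Hb k j; induction j as [|j IH].
  - rewrite Nat.add_0_r; simpl; lra.
  - rewrite Nat.add_succ_r; simpl. specialize (Hb (k + j)%nat). lra.
Qed.

(** The sum is returned through its tails and their recurrence, so that later arguments can peel off
    one term at a time. *)
Lemma series_tails (g : nat -> V -> R) (b : nat -> R) :
  (forall k, norm_le (g k) (b k)) -> (forall k, b (S k) <= b k / 2) ->
  exists s : nat -> V -> R,
    (forall k, s k = vadd (g k) (s (S k))) /\ (forall k, norm_le (s k) (2 * b k)).
Proof.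
  intros Hg Hb.
  assert (Hpos : forall k, 0 <= b k) by (intros k; eapply norm_le_nonneg; apply Hg).
  assert (Hex : forall k v, ex_series (fun j => g (k + j)%nat v)).
  { intros k v.
    apply (ex_series_le (fun j => g (k + j)%nat v) (fun j => b k * (1 / 2) ^ j)).
    - intros j. eapply Rle_trans; [apply (norm_le_coord _ _ v (Hg (k + j)%nat))|].
      apply halving_pow; auto.
    - apply (ex_series_scal_l (b k) (fun j => (1 / 2) ^ j)).
      apply ex_series_geom. rewrite Rabs_pos_eq; lra. }
  exists (fun k v => Series (fun j => g (k + j)%nat v)); split.
  - intros k; vext.
    rewrite Series_incr_1 by apply Hex.
    rewrite Nat.add_0_r. f_equal. apply Series_ext; intros j. f_equal; lia.
  - intros k.
    apply norm_le_lim with (p := fun n v => sum_n (fun j => g (k + j)%nat v) n).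
    + intros v. apply (Series_correct _ (Hex k v)).
    + intros n.
      (* The slack [b (k + n)] closes the induction: adding the next term costs [b (k + n + 1)],
         which is at most half of the slack. *)
      apply norm_le_weaken with (2 * b k - b (k + n)%nat);
        [|specialize (Hpos (k + n)%nat); lra].
      induction n as [|n IH].
      * replace (fun v => _) with (g k).
        { rewrite Nat.add_0_r. replace (2 * b k - b k) with (b k) by ring. apply Hg. }
        apply functional_extensionality; intro v.
        rewrite sum_O, Nat.add_0_r; auto.
      * replace (fun v => _) with
          (vadd (fun v => sum_n (fun j => g (k + j)%nat v) n) (g (k + S n)%nat)).
        { eapply norm_le_weaken; [apply norm_le_add; [apply IH|apply Hg]|].
          specialize (Hb (k + n)%nat). rewrite Nat.add_succ_r. lra. }
        apply functional_extensionality; intro v. rewrite sum_Sn; reflexivity.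
Qed.

End Norm.

(** * Closed cyclic subspaces of a linear contraction *)

(** Linearity is asked on [l2] only, because the adjoint is defined by choice and is uncontrolled on
    vectors whose sums over children diverge. *)
Definition linear_contraction {V : Type} (T : (V -> R) -> V -> R) : Prop :=
  (forall a x y, l2 x -> l2 y -> T (vadd (vscal a x) y) = vadd (vscal a (T x)) (T y)) /\
  (forall x r, norm_le x r -> norm_le (T x) r).

(* [poly_app T [c0; c1; ...] x = c0 x + c1 T x + ...], the real analogue of [lincomb] *)
Fixpoint poly_app {V : Type} (T : (V -> R) -> V -> R) (cs : list R) (x : V -> R) : V -> R :=
  match cs with
  | [] => vzero
  | c :: cs' => vadd (vscal c x) (poly_app T cs' (T x))
  end.

Fixpoint list_add (cs ds : list R) : list R :=
  match cs, ds with
  | [], _ => ds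
  | _, [] => cs
  | c :: cs', d :: ds' => (c + d) :: list_add cs' ds'
  end.

Definition l1norm (cs : list R) : R := fold_right (fun c s => Rabs c + s) 0 cs.

Definition in_cyclic_span {V : Type} (T : (V -> R) -> V -> R) (x y : V -> R) : Prop :=
  forall eps, 0 < eps -> exists cs, norm_le (vdiff (poly_app T cs x) y) eps.

Lemma l1norm_nonneg cs : 0 <= l1norm cs.
Proof.
  induction cs as [|c cs IH]; simpl; [lra|]. pose proof (Rabs_pos c); lra.
Qed.

Section PolyAlgebra.
Context {V : Type}.
Variable T : (V -> R) -> V -> R.
Implicit Types (x y : V -> R) (cs ds : list R).

Lemma poly_app_list_add cs ds x :
  poly_app T (list_add cs ds) x = vadd (poly_app T cs x) (poly_app T ds x).
Proof.
  revert ds x; induction cs as [|c cs IH]; intros [|d ds] x; simpl; try (vext; fail).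
  rewrite IH; vext.
Qed.

Lemma poly_app_map_scal a cs x :
  poly_app T (map (Rmult a) cs) x = vscal a (poly_app T cs x).
Proof.
  revert x; induction cs as [|c cs IH]; intros x; simpl; [vext|]. rewrite IH; vext.
Qed.

Lemma poly_app_shift n cs x :
  poly_app T (repeat 0 n ++ cs) x = poly_app T cs (Nat.iter n T x).
Proof.
  revert x; induction n as [|n IH]; intros x; auto.
  cbn [repeat app poly_app]. rewrite IH, Nat.iter_succ_r. vext.
Qed.

End PolyAlgebra.

Section Contraction.
Context {V : Type}.
Variable T : (V -> R) -> V -> R.
Hypothesis HT : linear_contraction T.
Implicit Types (x y : V -> R) (cs ds : list R).

Lemma op_norm x r : norm_le x r -> norm_le (T x) r.
Proof. apply HT. Qed.

Lemma op_l2 x : l2 x -> l2 (T x).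
Proof. intros [r H]; exists r; apply op_norm; auto. Qed.

Lemma op_add x y : l2 x -> l2 y -> T (vadd x y) = vadd (T x) (T y).
Proof.
  intros Hx Hy.
  replace (vadd x y) with (vadd (vscal 1 x) y) by vext.
  rewrite (proj1 HT) by auto. vext.
Qed.

Lemma op_zero : T vzero = vzero.
Proof.
  replace (@vzero V) with (vadd (vscal (-1) (@vzero V)) vzero) at 1 by vext.
  rewrite (proj1 HT) by apply l2_zero. vext.
Qed.

Lemma op_scal a x : l2 x -> T (vscal a x) = vscal a (T x).
Proof.
  intros Hx.
  replace (vscal a x) with (vadd (vscal a x) vzero) by vext.
  rewrite (proj1 HT), op_zero by (auto using l2_zero). vext.
Qed.

Lemma op_diff x y : l2 x -> l2 y -> T (vdiff x y) = vdiff (T x) (T y).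
Proof.
  intros Hx Hy.
  replace (vdiff x y) with (vadd (vscal (-1) y) x) by vext.
  rewrite (proj1 HT) by auto. vext.
Qed.

Lemma iter_norm n x r : norm_le x r -> norm_le (Nat.iter n T x) r.
Proof. induction n; simpl; auto using op_norm. Qed.

Lemma iter_l2 n x : l2 x -> l2 (Nat.iter n T x).
Proof. intros [r H]; exists r; apply iter_norm; auto. Qed.

Lemma iter_add n x y : l2 x -> l2 y ->
  Nat.iter n T (vadd x y) = vadd (Nat.iter n T x) (Nat.iter n T y).
Proof.
  intros Hx Hy; induction n as [|n IH]; simpl; auto.
  rewrite IH; apply op_add; apply iter_l2; auto.
Qed.

Lemma iter_scal n a x : l2 x -> Nat.iter n T (vscal a x) = vscal a (Nat.iter n T x).
Proof.
  intros Hx; induction n as [|n IH]; simpl; auto.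
  rewrite IH; apply op_scal; apply iter_l2; auto.
Qed.

Lemma iter_zero n : Nat.iter n T vzero = vzero.
Proof. induction n as [|n IH]; simpl; auto. rewrite IH; apply op_zero. Qed.

Lemma iter_vanish m n x : Nat.iter m T x = vzero -> (m <= n)%nat ->
  Nat.iter n T x = vzero.
Proof.
  intros H Hmn. replace n with ((n - m) + m)%nat by lia.
  rewrite Nat.iter_add, H. apply iter_zero.
Qed.

Lemma poly_app_norm cs x r : norm_le x r -> norm_le (poly_app T cs x) (l1norm cs * r).
Proof.
  revert x; induction cs as [|c cs IH]; intros x Hx; simpl.
  - eapply norm_le_weaken; [apply norm_le_zero|lra].
  - rewrite Rmult_plus_distr_r. apply norm_le_add; [apply norm_le_scal; auto|].
    apply IH, op_norm; auto.
Qed.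

Lemma poly_app_l2 cs x : l2 x -> l2 (poly_app T cs x).
Proof. intros [r H]; eexists; apply poly_app_norm; eauto. Qed.

Lemma poly_app_add cs x y : l2 x -> l2 y ->
  poly_app T cs (vadd x y) = vadd (poly_app T cs x) (poly_app T cs y).
Proof.
  revert x y; induction cs as [|c cs IH]; intros x y Hx Hy; simpl; [vext|].
  rewrite op_add, IH by auto using op_l2. vext.
Qed.

Lemma poly_app_scal cs a x : l2 x ->
  poly_app T cs (vscal a x) = vscal a (poly_app T cs x).
Proof.
  revert x; induction cs as [|c cs IH]; intros x Hx; simpl; [vext|].
  rewrite op_scal, IH by auto using op_l2. vext.
Qed.

Lemma poly_app_op cs x : l2 x -> poly_app T cs (T x) = T (poly_app T cs x).
Proof.
  revert x; induction cs as [|c cs IH]; intros x Hx; simpl.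
  - rewrite op_zero; auto.
  - rewrite IH by auto using op_l2.
    rewrite (proj1 HT) by auto using poly_app_l2, op_l2. auto.
Qed.

Lemma poly_app_iter cs n x : l2 x ->
  poly_app T cs (Nat.iter n T x) = Nat.iter n T (poly_app T cs x).
Proof.
  intros Hx; induction n as [|n IH]; simpl; auto.
  rewrite poly_app_op, IH by auto using iter_l2. auto.
Qed.

Lemma cyclic_span_poly cs x : in_cyclic_span T x (poly_app T cs x).
Proof.
  intros eps He; exists cs.
  replace (vdiff _ _) with (@vzero V) by vext.
  eapply norm_le_weaken; [apply norm_le_zero|lra].
Qed.

Lemma cyclic_span_zero x : in_cyclic_span T x vzero.
Proof. exact (cyclic_span_poly [] x). Qed.

Lemma cyclic_span_self x : in_cyclic_span T x x.
Proof.
  replace x with (poly_app T [1] x) at 2 by (simpl; vext). apply cyclic_span_poly.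
Qed.

Lemma cyclic_span_add x y z :
  in_cyclic_span T x y -> in_cyclic_span T x z -> in_cyclic_span T x (vadd y z).
Proof.
  intros Hy Hz eps He.
  destruct (Hy (eps / 2)) as [cs Hc]; [lra|].
  destruct (Hz (eps / 2)) as [ds Hd]; [lra|].
  exists (list_add cs ds). rewrite poly_app_list_add.
  replace (vdiff _ _) with (vadd (vdiff (poly_app T cs x) y) (vdiff (poly_app T ds x) z))
    by vext.
  replace eps with (eps / 2 + eps / 2) by field. apply norm_le_add; auto.
Qed.

Lemma cyclic_span_scal a x y : in_cyclic_span T x y -> in_cyclic_span T x (vscal a y).
Proof.
  intros Hy eps He. pose proof (Rabs_pos a) as Ha.
  destruct (Hy (eps / (Rabs a + 1))) as [cs Hc]; [apply Rdiv_lt_0_compat; lra|].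
  exists (map (Rmult a) cs). rewrite poly_app_map_scal.
  replace (vdiff _ _) with (vscal a (vdiff (poly_app T cs x) y)) by vext.
  eapply norm_le_weaken; [apply norm_le_scal; eauto|].
  apply (Rmult_le_reg_r (Rabs a + 1)); [lra|].
  replace (Rabs a * (eps / (Rabs a + 1)) * (Rabs a + 1)) with (Rabs a * eps)
    by (field; lra).
  nra.
Qed.

Lemma cyclic_span_diff x y z :
  in_cyclic_span T x y -> in_cyclic_span T x z -> in_cyclic_span T x (vdiff y z).
Proof.
  intros Hy Hz. replace (vdiff y z) with (vadd y (vscal (-1) z)) by vext.
  apply cyclic_span_add, cyclic_span_scal; auto.
Qed.

Lemma cyclic_span_op x y : l2 x -> l2 y ->
  in_cyclic_span T x y -> in_cyclic_span T x (T y).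
Proof.
  intros Hx Hy H eps He. destruct (H eps He) as [cs Hc].
  exists (0 :: cs); simpl.
  replace (vdiff _ _) with (T (vdiff (poly_app T cs x) y)); [apply op_norm; auto|].
  rewrite op_diff, poly_app_op by auto using poly_app_l2. vext.
Qed.

Lemma cyclic_span_closed x y :
  (forall eps, 0 < eps -> exists z, in_cyclic_span T x z /\ norm_le (vdiff z y) eps) ->
  in_cyclic_span T x y.
Proof.
  intros H eps He.
  destruct (H (eps / 2)) as (z & Hz & Hzy); [lra|].
  destruct (Hz (eps / 2)) as [cs Hc]; [lra|].
  exists cs.
  replace (vdiff _ y) with (vadd (vdiff (poly_app T cs x) z) (vdiff z y)) by vext.
  replace eps with (eps / 2 + eps / 2) by field. apply norm_le_add; auto.
Qed.

Lemma cyclic_span_poly_app cs x y : l2 x -> l2 y ->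
  in_cyclic_span T x y -> in_cyclic_span T x (poly_app T cs y).
Proof.
  intros Hx; revert y; induction cs as [|c cs IH]; intros y Hy H; simpl.
  - apply cyclic_span_zero.
  - apply cyclic_span_add; [apply cyclic_span_scal; auto|].
    apply IH; auto using op_l2, cyclic_span_op.
Qed.

End Contraction.

(** * Adding a nilpotent part to a cyclic vector *)

Section NilpotentPart.
Context {V I : Type}.
Variable T : (V -> R) -> V -> R.
Hypothesis HT : linear_contraction T.
Variables (par : I -> option I) (kap : I -> V -> R) (enum : nat -> I) (f : V -> R).
Hypothesis kap_l2 : forall i, l2 (kap i).
Hypothesis kap_op : forall i, T (kap i) = match par i with Some j => kap j | None => vzero end.
Hypothesis kap_nilpotent : forall i, exists m, Nat.iter m T (kap i) = vzero.
Hypothesis has_child : forall i, exists j, par j = Some i.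
Hypothesis enum_surj : forall i, exists n, enum n = i.
Hypothesis f_l2 : l2 f.
Hypothesis f_null : forall d, 0 < d -> exists p, norm_le (poly_app T (1 :: p) f) d.

(** Descending [n] generations from [i] gives an exact preimage of [kap i] under [T^n]. *)
Lemma kap_lift n i : exists j, Nat.iter n T (kap j) = kap i.
Proof.
  revert i; induction n as [|n IH]; intros i; [exists i; auto|].
  destruct (IH i) as [j Hj]. destruct (has_child j) as [j' Hj'].
  exists j'. rewrite Nat.iter_succ_r, kap_op, Hj'; auto.
Qed.

(** The first component of the Cantor pairing takes each value infinitely often, so every index is
    served at arbitrarily late stages, where the error is small. *)
Definition target (k : nat) : I := enum (fst (of_nat k)).

Lemma target_recurrent i K : exists k, (K <= k)%nat /\ target k = i.
Proof.
  destruct (enum_surj i) as [n Hn]. exists (to_nat (n, K)); split.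
  - pose proof (to_nat_non_decreasing n K); lia.
  - unfold target; rewrite cancel_of_to; auto.
Qed.

(* One step of the construction: all previous terms are killed by [T^A], and
   [B] bounds the norm that the next term [eps z] is allowed to have.  The
   polynomial [1 :: p] is chosen after [eps], which is what makes
   [p(T) f / eps] small. *)
Lemma perturbation_step k (A : nat) (B : R) :
  exists q : ((I * R) * (list R * nat)), 0 < B ->
    let '((j, eps), (p, A')) := q in
    0 < eps /\ norm_le (vscal eps (kap j)) B /\
    Nat.iter A T (kap j) = kap (target k) /\
    Nat.iter A' T (kap j) = vzero /\ (A <= A')%nat /\
    norm_le (poly_app T (1 :: p) f) (eps / INR (S k)).
Proof.
  destruct (kap_lift A (target k)) as [j Hj].
  destruct (kap_l2 j) as [r Hr].
  pose proof (norm_le_nonneg _ _ Hr) as Hr0.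
  pose proof (lt_0_INR (S k) (Nat.lt_0_succ k)) as Hk.
  (* Nothing is claimed for [B <= 0]; the dummy value keeps the step a total function of its state,
     so that it can be iterated before positivity of the bounds is known. *)
  destruct (Rlt_dec 0 B) as [HB|HB];
    [|exists ((j, 0), ([], O)); intros; contradiction].
  set (eps := B / (r + 1)).
  assert (He : 0 < eps) by (apply Rdiv_lt_0_compat; lra).
  destruct (f_null (eps / INR (S k))) as [p Hp]; [apply Rdiv_lt_0_compat; auto|].
  destruct (kap_nilpotent j) as [m Hm].
  exists ((j, eps), (p, max A m)); intros _.
  split; [auto|split; [|split; [auto|split; [|split; [lia|auto]]]]].
  - apply norm_le_weaken with (Rabs eps * r); [apply norm_le_scal; auto|].
    rewrite Rabs_pos_eq by lra. unfold eps.
    apply (Rmult_le_reg_r (r + 1)); [lra|].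
    replace (B / (r + 1) * r * (r + 1)) with (B * r) by (field; lra). nra.
  - apply (iter_vanish T HT m); auto; lia.
Qed.

Lemma perturbation_data :
  exists (j : nat -> I) (eps : nat -> R) (p : nat -> list R) (A : nat -> nat) (B : nat -> R),
  forall k,
    0 < eps k /\ norm_le (vscal (eps k) (kap (j k))) (B k) /\
    Nat.iter (A k) T (kap (j k)) = kap (target k) /\
    Nat.iter (A (S k)) T (kap (j k)) = vzero /\ (A k <= A (S k))%nat /\
    norm_le (poly_app T (1 :: p k) f) (eps k / INR (S k)) /\
    B (S k) <= B k / 2 /\
    l1norm (1 :: p k) * (2 * B (S k)) <= eps k / INR (S k).
Proof.
  set (step := fun k A B => proj1_sig
    (constructive_indefinite_description _ (perturbation_step k A B))).
  (* The new bound is at most half of the old one, for geometric decay, and is divided by the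
     [l1norm] of [1 :: p], so that this polynomial keeps the whole tail below [eps / (k + 1)]. *)
  set (next := fun k (st : nat * R) =>
    let '((j, eps), (p, A')) := step k (fst st) (snd st) in
    (A', Rmin (snd st / 2) (eps / INR (S k) / (2 * (l1norm (1 :: p) + 1))))).
  set (st := nat_rect (fun _ => (nat * R)%type) (O, 1) next).
  set (q := fun k => step k (fst (st k)) (snd (st k))).
  assert (Hq : forall k, 0 < snd (st k) ->
    let '((j, eps), (p, A')) := q k in
    0 < eps /\ norm_le (vscal eps (kap j)) (snd (st k)) /\
    Nat.iter (fst (st k)) T (kap j) = kap (target k) /\
    Nat.iter A' T (kap j) = vzero /\ (fst (st k) <= A')%nat /\
    norm_le (poly_app T (1 :: p) f) (eps / INR (S k))).
  { intros k. unfold q, step.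
    exact (proj2_sig (constructive_indefinite_description _
             (perturbation_step k (fst (st k)) (snd (st k))))). }
  assert (Hst : forall k, st (S k) =
    let '((j, eps), (p, A')) := q k in
    (A', Rmin (snd (st k) / 2) (eps / INR (S k) / (2 * (l1norm (1 :: p) + 1))))).
  { intros k; reflexivity. }
  assert (HB : forall k, 0 < snd (st k)).
  { induction k as [|k IH]; [simpl; lra|].
    specialize (Hq k IH). rewrite Hst.
    destruct (q k) as [[j eps] [p A']]. destruct Hq as (He & _).
    pose proof (lt_0_INR (S k) (Nat.lt_0_succ k)) as Hk.
    pose proof (l1norm_nonneg (1 :: p)).
    cbn [snd]. apply Rmin_glb_lt; [lra|].
    apply Rdiv_lt_0_compat; [apply Rdiv_lt_0_compat; auto|lra]. }
  exists (fun k => fst (fst (q k))), (fun k => snd (fst (q k))),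
    (fun k => fst (snd (q k))), (fun k => fst (st k)), (fun k => snd (st k)).
  intros k. specialize (Hq k (HB k)). rewrite Hst.
  destruct (q k) as [[j eps] [p A']]. cbn [fst snd].
  destruct Hq as (H1 & H2 & H3 & H4 & H5 & H6).
  do 6 (split; [assumption|]). split.
  - apply Rmin_l.
  - pose proof (l1norm_nonneg (1 :: p)) as Hl.
    pose proof (lt_0_INR (S k) (Nat.lt_0_succ k)) as Hk.
    set (l := l1norm (1 :: p)) in *.
    set (c := eps / INR (S k)).
    assert (Hc : 0 < c) by (apply Rdiv_lt_0_compat; auto).
    apply Rle_trans with (l * (2 * (c / (2 * (l + 1))))).
    + apply Rmult_le_compat_l; auto.
      apply Rmult_le_compat_l; [lra|]. apply Rmin_r.
    + replace (l * (2 * (c / (2 * (l + 1))))) with (c - c / (l + 1)) by (field; lra).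
      assert (0 < c / (l + 1)) by (apply Rdiv_lt_0_compat; lra). lra.
Qed.

Theorem cyclic_span_nilpotent_extension :
  exists x, l2 x /\ in_cyclic_span T x f /\ forall i, in_cyclic_span T x (kap i).
Proof.
  destruct perturbation_data as (j & eps & p & A & B & H).
  destruct (series_tails (fun k => vscal (eps k) (kap (j k))) B) as (s & Hs & Hsn);
    [apply H|apply H|].
  assert (Hsl : forall k, l2 (s k)) by (intros k; eexists; apply Hsn).
  assert (Hmono : forall k m, (k <= m)%nat -> (A k <= A m)%nat).
  { intros k m Hkm; induction Hkm as [|m Hm IH]; auto.
    specialize (H m) as (_ & _ & _ & _ & H & _). lia. }
  (* [T^(A k)] annihilates every term of index below [k], so only the tail [s k] survives. *)
  assert (Hkill : forall k m, (m <= k)%nat ->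
    Nat.iter (A k) T (s O) = Nat.iter (A k) T (s m)).
  { intros k; induction m as [|m IH]; intros Hm; auto.
    rewrite IH, Hs, iter_add, iter_scal by (auto using l2_scal; lia).
    rewrite (iter_vanish T HT (A (S m)) (A k) (kap (j m))); [vext|apply H|apply Hmono; lia]. }
  set (x := vadd f (s O)).
  assert (Hx : l2 x) by (apply l2_add; auto).
  exists x.
  (* The span comes arbitrarily close to [p(T) (kap i)] for polynomials [p] with [p(0) = 1], but [p]
     varies with the accuracy. *)
  assert (Hnear : forall i d, 0 < d -> exists q y, in_cyclic_span T x y /\
            norm_le (vdiff y (poly_app T (1 :: q) (kap i))) d).
  { intros i d Hd.
    destruct (nfloor_ex (2 / d)) as [K HK].
    { apply Rlt_le, Rdiv_lt_0_compat; lra. }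
    destruct (target_recurrent i K) as (k & Hk & Ht).
    exists (p k), (vscal (/ eps k) (poly_app T (repeat 0 (A k) ++ (1 :: p k)) x)); split.
    { apply cyclic_span_scal; auto. apply cyclic_span_poly. }
    destruct (H k) as (He & _ & HA & _ & _ & Hp & HB & Hl). rewrite Ht in HA.
    set (P := 1 :: p k) in *.
    rewrite poly_app_shift. unfold x.
    rewrite iter_add, (Hkill k k), Hs, iter_add, iter_scal, HA
      by (auto using l2_scal).
    repeat rewrite (poly_app_add T HT) by auto 6 using iter_l2, l2_add, l2_scal.
    rewrite poly_app_scal, poly_app_iter by auto.
    (* Two errors remain, the image of [f] and the image of the later terms; each has norm at most
       [eps k / (k + 1)] before division by [eps k]. *)
    replace (vdiff _ _) with
      (vscal (/ eps k) (vadd (Nat.iter (A k) T (poly_app T P f))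
         (poly_app T P (Nat.iter (A k) T (s (S k)))))).
    2:{ vext. field. lra. }
    pose proof (lt_0_INR (S k) (Nat.lt_0_succ k)) as Hk0.
    apply norm_le_weaken with (Rabs (/ eps k) * (eps k / INR (S k) + eps k / INR (S k))).
    - apply norm_le_scal, norm_le_add; [apply iter_norm; auto|].
      eapply norm_le_weaken; [|apply Hl].
      apply poly_app_norm; auto. apply iter_norm; auto.
    - rewrite Rabs_pos_eq by (apply Rlt_le, Rinv_0_lt_compat; auto).
      replace (/ eps k * (eps k / INR (S k) + eps k / INR (S k)))
        with (2 / INR (S k)) by (field; lra).
      assert (Hb : 2 / d < INR (S k)).
      { eapply Rlt_le_trans; [apply HK|]. rewrite S_INR.
        apply Rplus_le_compat_r, le_INR; auto. }
      apply (Rmult_le_reg_r (INR (S k))); auto.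
      replace (2 / INR (S k) * INR (S k)) with ((2 / d) * d) by (field; lra). nra. }
  (* Induction on the nilpotency index: the terms of [p(T) (kap i)] of positive degree are
     polynomials in [T (kap i)], which is already in the span, so they can be subtracted whatever
     [p] is. *)
  assert (Hkap : forall m i, Nat.iter m T (kap i) = vzero -> in_cyclic_span T x (kap i)).
  { induction m as [|m IH]; intros i Hi.
    - simpl in Hi; rewrite Hi; apply cyclic_span_zero.
    - assert (HTi : in_cyclic_span T x (T (kap i))).
      { rewrite kap_op. destruct (par i) as [i'|] eqn:Ei; [|apply cyclic_span_zero].
        apply IH. rewrite Nat.iter_succ_r, kap_op, Ei in Hi; auto. }
      apply cyclic_span_closed; intros d Hd.
      destruct (Hnear i d Hd) as (q & y & Hy & Hyn).
      exists (vdiff y (poly_app T q (T (kap i)))); split.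
      + apply cyclic_span_diff; auto.
        apply cyclic_span_poly_app; auto. apply op_l2; auto.
      + replace (vdiff _ _) with (vdiff y (poly_app T (1 :: q) (kap i)));
          [auto|simpl; vext]. }
  assert (Hall : forall i, in_cyclic_span T x (kap i)).
  { intros i; destruct (kap_nilpotent i) as [m Hm]; eauto. }
  split; [auto|split; [|auto]].
  (* All the [kap] are in the span, hence the partial sums of the perturbation are, then its sum
     [s O], and finally [f = x - s O]. *)
  replace f with (vdiff x (s O)) by (unfold x; vext).
  apply cyclic_span_diff; [apply cyclic_span_self|].
  apply cyclic_span_closed; intros d Hd.
  assert (Hpart : forall k, in_cyclic_span T x (vdiff (s O) (s k))).
  { induction k as [|k IH].
    - replace (vdiff _ _) with (@vzero V) by vext. apply cyclic_span_zero.
    - replace (vdiff _ _) with (vadd (vdiff (s O) (s k)) (vscal (eps k) (kap (j k)))).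
      + apply cyclic_span_add, cyclic_span_scal; auto.
      + rewrite (Hs k); vext. }
  assert (Hlim : exists k, 2 * B k <= d).
  { pose proof (norm_le_nonneg _ _ (Hsn O)) as HB0.
    destruct (pow_lt_1_zero (1 / 2)) with (y := d / (2 * B O + 1)) as [k Hk].
    - rewrite Rabs_pos_eq; lra.
    - apply Rdiv_lt_0_compat; lra.
    - exists k. specialize (Hk k (Nat.le_refl k)).
      assert (HBk : forall k, B (S k) <= B k / 2) by (intros i; apply H).
      pose proof (halving_pow B HBk O k) as Hpw.
      simpl in Hpw.
      assert (0 <= (1 / 2) ^ k) by (apply pow_le; lra).
      rewrite Rabs_pos_eq in Hk by auto.
      apply Rle_trans with ((2 * B O + 1) * (1 / 2) ^ k); [nra|].
      replace d with ((2 * B O + 1) * (d / (2 * B O + 1))) by (field; lra).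
      apply Rmult_le_compat_l; lra. }
  destruct Hlim as [k Hk].
  exists (vdiff (s O) (s k)); split; auto.
  replace (vdiff _ _) with (vscal (-1) (s k)) by vext.
  eapply norm_le_weaken; [apply norm_le_scal, Hsn|].
  rewrite Rabs_left; lra.
Qed.

End NilpotentPart.

(** * Fourier coefficients and Bessel's inequality *)

Definition avg (g : R -> R) : R := RInt g 0 (2 * PI) / (2 * PI).

Definition Rcont (g : R -> R) : Prop := forall t, continuous g t.

Lemma Rcont_plus g h : Rcont g -> Rcont h -> Rcont (fun t => g t + h t).
Proof. intros Hg Hh t. apply (continuous_plus g h); auto. Qed.

Lemma Rcont_minus g h : Rcont g -> Rcont h -> Rcont (fun t => g t - h t).
Proof. intros Hg Hh t. apply (continuous_minus g h); auto. Qed.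

Lemma Rcont_mult g h : Rcont g -> Rcont h -> Rcont (fun t => g t * h t).
Proof. intros Hg Hh t. apply (continuous_mult g h); auto. Qed.

Lemma Rcont_const c : Rcont (fun _ => c).
Proof. intros t; apply continuous_const. Qed.

Lemma Rcont_cos m : Rcont (fun t => cos (m * t)).
Proof.
  intros t. apply (continuous_comp (fun t => m * t) cos).
  - apply (continuous_mult (fun _ => m) (fun t => t));
      [apply continuous_const|apply continuous_id].
  - apply continuity_pt_filterlim, continuity_cos.
Qed.

Lemma Rcont_sin m : Rcont (fun t => sin (m * t)).
Proof.
  intros t. apply (continuous_comp (fun t => m * t) sin).
  - apply (continuous_mult (fun _ => m) (fun t => t));
      [apply continuous_const|apply continuous_id].
  - apply continuity_pt_filterlim, continuity_sin.
Qed.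

Lemma Rcont_ext g h : (forall t, g t = h t) -> Rcont g -> Rcont h.
Proof. intros H Hg t. apply continuous_ext with g; auto. Qed.

Lemma Rcont_ex_RInt g a b : Rcont g -> ex_RInt g a b.
Proof. intros H. apply (ex_RInt_continuous (V := R_CompleteNormedModule)); auto. Qed.

Create HintDb rcont.
Hint Resolve Rcont_plus Rcont_minus Rcont_mult Rcont_const Rcont_cos Rcont_sin
  Rcont_ex_RInt : rcont.

Lemma avg_ext g h : (forall t, g t = h t) -> avg g = avg h.
Proof. intros H. unfold avg. f_equal. apply RInt_ext; auto. Qed.

Lemma avg_axpy a g h : Rcont g -> Rcont h ->
  avg (fun t => a * g t + h t) = a * avg g + avg h.
Proof.
  intros Hg Hh. pose proof PI_RGT_0. unfold avg.
  rewrite (RInt_plus (V := R_CompleteNormedModule) (fun t => a * g t) h)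
    by auto with rcont.
  rewrite (RInt_scal (V := R_CompleteNormedModule) g) by auto with rcont.
  unfold plus, scal; simpl; unfold mult; simpl. field. lra.
Qed.

Lemma avg_const c : avg (fun _ => c) = c.
Proof.
  pose proof PI_RGT_0. unfold avg. rewrite RInt_const.
  unfold scal; simpl; unfold mult; simpl. field. lra.
Qed.

Lemma avg_le g h : Rcont g -> Rcont h -> (forall t, g t <= h t) -> avg g <= avg h.
Proof.
  intros Hg Hh H. pose proof PI_RGT_0. unfold avg.
  apply Rmult_le_compat_r; [apply Rlt_le, Rinv_0_lt_compat; lra|].
  apply RInt_le; auto with rcont. lra.
Qed.

Lemma avg_cos (m : Z) : avg (fun t => cos (IZR m * t)) = if Z.eq_dec m 0 then 1 else 0.
Proof.
  destruct (Z.eq_dec m 0) as [->|Hm].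
  - rewrite <- (avg_const 1). apply avg_ext; intros t.
    rewrite Rmult_0_l; apply cos_0.
  - assert (Hm' : IZR m <> 0) by (apply not_0_IZR; auto).
    unfold avg.
    rewrite (is_RInt_unique (fun t => cos (IZR m * t)) 0 (2 * PI)
      (minus (sin (IZR m * (2 * PI)) / IZR m) (sin (IZR m * 0) / IZR m))).
    + rewrite (sin_eq_0_1 (IZR m * (2 * PI))), Rmult_0_r, sin_0.
      * unfold minus, plus, opp; simpl. unfold Rdiv. ring.
      * exists (2 * m)%Z. rewrite mult_IZR. ring.
    + apply (is_RInt_derive (fun t => sin (IZR m * t) / IZR m)).
      * intros t _. auto_derive; auto. field; auto.
      * intros t _. apply Rcont_cos.
Qed.

Definition Ccont (F : R -> R * R) : Prop :=
  Rcont (fun t => fst (F t)) /\ Rcont (fun t => snd (F t)).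

(* For [F = F1 + i F2] this is the real part of the usual Fourier coefficient;
   it suffices because all the functions below satisfy [F(-t) = conj (F t)]. *)
Definition fcoef (F : R -> R * R) (m : Z) : R :=
  avg (fun t => fst (F t) * cos (IZR m * t) + snd (F t) * sin (IZR m * t)).

Lemma fcoef_ext F G m : (forall t, F t = G t) -> fcoef F m = fcoef G m.
Proof. intros H; apply avg_ext; intros t; rewrite H; auto. Qed.

Lemma fcoef_axpy a F G m : Ccont F -> Ccont G ->
  fcoef (fun t => (a * fst (F t) + fst (G t), a * snd (F t) + snd (G t))) m
  = a * fcoef F m + fcoef G m.
Proof.
  intros [] []. unfold fcoef. rewrite <- avg_axpy by auto with rcont.
  apply avg_ext; intros t; simpl; ring.
Qed.

Lemma fcoef_exp k m :
  fcoef (fun t => (cos (IZR k * t), sin (IZR k * t))) m = if Z.eq_dec k m then 1 else 0.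
Proof.
  unfold fcoef. cbn [fst snd].
  rewrite (avg_ext _ (fun t => cos (IZR (k - m) * t))), avg_cos.
  - destruct (Z.eq_dec k m), (Z.eq_dec (k - m) 0); auto; lia.
  - intros t. rewrite minus_IZR, Rmult_minus_distr_r, cos_minus. ring.
Qed.

Lemma Ccont_exp k : Ccont (fun t => (cos (IZR k * t), sin (IZR k * t))).
Proof. split; simpl; auto with rcont. Qed.

Lemma Ccont_axpy a F G : Ccont F -> Ccont G ->
  Ccont (fun t => (a * fst (F t) + fst (G t), a * snd (F t) + snd (G t))).
Proof. intros [] []; split; simpl; auto with rcont. Qed.

(** Subtracting [d] times the [k]-th exponential lowers the mean square by exactly [d^2] and leaves
    the other coefficients unchanged, so the list can be treated one index at a time. *)
Lemma Bessel L : NoDup L -> forall F, Ccont F ->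
  Rsum_list (fun m => fcoef F m * fcoef F m) L
  <= avg (fun t => fst (F t) * fst (F t) + snd (F t) * snd (F t)).
Proof.
  induction L as [|k L IH]; intros HL F HF; simpl.
  - rewrite <- (avg_const 0). destruct HF.
    apply avg_le; auto with rcont. intros t; nra.
  - inversion_clear HL as [|? ? Hk HL'].
    set (d := fcoef F k).
    set (E := fun t => (cos (IZR k * t), sin (IZR k * t))).
    set (G := fun t => (- d * fst (E t) + fst (F t), - d * snd (E t) + snd (F t))).
    assert (HE : Ccont E) by apply Ccont_exp.
    assert (HG : Ccont G) by (apply Ccont_axpy; auto).
    specialize (IH HL' G HG).
    rewrite (Rsum_list_ext _ (fun m => fcoef F m * fcoef F m)) in IH.
    2:{ intros m Hm. unfold G. rewrite fcoef_axpy by auto.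
        unfold E; rewrite fcoef_exp.
        destruct (Z.eq_dec k m) as [->|]; [contradiction|]. ring. }
    assert (Hav : avg (fun t => fst (G t) * fst (G t) + snd (G t) * snd (G t))
      = avg (fun t => fst (F t) * fst (F t) + snd (F t) * snd (F t)) - d * d).
    { transitivity (avg (fun t => (-2 * d) *
          (fst (F t) * cos (IZR k * t) + snd (F t) * sin (IZR k * t))
        + (1 * (fst (F t) * fst (F t) + snd (F t) * snd (F t)) + d * d))).
      - apply avg_ext; intros t; unfold G, E; simpl.
        pose proof (sin2_cos2 (IZR k * t)) as Hsc; unfold Rsqr in Hsc.
        set (c := cos (IZR k * t)) in *; set (s := sin (IZR k * t)) in *.
        replace (d * d) with (d * d * (s * s + c * c)) by (rewrite Hsc; ring). ring.
      - destruct HF. rewrite !avg_axpy, avg_const by auto 10 with rcont.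
        fold (fcoef F k). fold d. ring. }
    lra.
Qed.

(** The index is negated because multiplication by [z] raises frequencies, whereas the operator
    modelled later is the backward shift. *)
Lemma norm_le_fcoef F d : 0 <= d -> Ccont F ->
  (forall t, fst (F t) * fst (F t) + snd (F t) * snd (F t) <= d * d) ->
  norm_le (fun k => fcoef F (- k)) d.
Proof.
  intros Hd HF H; split; auto. intros L HL.
  replace (Rsum_list _ L) with
    (Rsum_list (fun m => fcoef F m * fcoef F m) (map Z.opp L)).
  - eapply Rle_trans; [apply Bessel; auto|].
    + apply Injective_map_NoDup; auto. intros a b; lia.
    + rewrite <- (avg_const (d * d)). destruct HF. apply avg_le; auto with rcont.
  - clear HL; induction L as [|a L IH]; simpl; auto. rewrite IH; auto.
Qed.

(** * Polynomial approximation on the circle with a weight vanishing at 1 *)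

Fixpoint peval (p : list R) (z : Complex.C) : Complex.C :=
  match p with
  | [] => RtoC 0
  | c :: p' => (RtoC c + z * peval p' z)%C
  end.

Fixpoint list_mul (p q : list R) : list R :=
  match p with
  | [] => []
  | c :: p' => list_add (map (Rmult c) q) (0 :: list_mul p' q)
  end.

Lemma peval_add p q z : peval (list_add p q) z = (peval p z + peval q z)%C.
Proof.
  revert q; induction p as [|c p IH]; intros [|d q]; simpl; try ring.
  rewrite IH, RtoC_plus; ring.
Qed.

Lemma peval_scal a p z : peval (map (Rmult a) p) z = (RtoC a * peval p z)%C.
Proof.
  induction p as [|c p IH]; simpl; [ring|]. rewrite IH, RtoC_mult; ring.
Qed.

Lemma peval_mul p q z : peval (list_mul p q) z = (peval p z * peval q z)%C.
Proof.
  induction p as [|c p IH]; simpl; [ring|].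
  rewrite peval_add, peval_scal; simpl; rewrite IH; ring.
Qed.

Definition on_circle (z : Complex.C) : Prop := Cmod z = 1 /\ z <> RtoC 1.

(** The numerator 2 makes this at least 1 on the circle, so that its powers increase with the
    exponent. *)
Definition blowup (z : Complex.C) : R := 2 / Cmod (RtoC 1 - z)%C.

(* [G] is approximated by polynomials at rate [1/N], up to a power of
   [1/|1-z|]; unlike uniform weighted approximability this is stable under
   products.  [c0] is the common value at [0] of the approximants. *)
Definition approximable (c0 : R) (G : Complex.C -> Complex.C) : Prop :=
  exists K m, 0 <= K /\ forall N, (1 <= N)%nat -> exists p,
    peval p (RtoC 0) = RtoC c0 /\
    forall z, on_circle z ->
      Cmod (peval p z - G z)%C <= K * blowup z ^ m / INR N /\
      Cmod (G z) <= K * blowup z ^ m.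

Lemma one_minus_neq0 z : on_circle z -> (RtoC 1 - z)%C <> RtoC 0.
Proof.
  intros [_ Hz] H; apply Hz.
  replace z with (RtoC 1 - (RtoC 1 - z))%C by ring. rewrite H; ring.
Qed.

Lemma Cmod_one_minus_pos z : on_circle z -> 0 < Cmod (RtoC 1 - z)%C.
Proof. intros H. apply Cmod_gt_0, one_minus_neq0; auto. Qed.

Lemma Cmod_one_minus_pow z n : Cmod z = 1 -> Cmod (RtoC 1 - z ^ n)%C <= 2.
Proof.
  intros Hz. unfold Cminus.
  eapply Rle_trans; [apply Cmod_triangle|].
  rewrite Cmod_opp, Cmod_pow, Hz, pow1, Cmod_1. lra.
Qed.

Lemma blowup_ge1 z : on_circle z -> 1 <= blowup z.
Proof.
  intros H. pose proof (Cmod_one_minus_pos z H) as Hp.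
  pose proof (Cmod_one_minus_pow z 1 (proj1 H)) as H2.
  replace (z ^ 1)%C with z in H2 by (simpl; ring).
  unfold blowup. apply (Rmult_le_reg_r (Cmod (RtoC 1 - z)%C)); auto.
  unfold Rdiv. rewrite Rmult_assoc, Rinv_l by lra. lra.
Qed.

Lemma blowup_pow_le z m n : on_circle z -> (m <= n)%nat -> blowup z ^ m <= blowup z ^ n.
Proof. intros H Hmn. apply Rle_pow; auto. apply blowup_ge1; auto. Qed.

Lemma approximable_const c : approximable c (fun _ => RtoC c).
Proof.
  exists (Rabs c), O; split; [apply Rabs_pos|].
  intros N HN; exists [c]; split; [simpl; ring|].
  intros z Hz; simpl. rewrite Cmod_R.
  replace (RtoC c + z * RtoC 0 - RtoC c)%C with (RtoC 0) by ring.
  rewrite Cmod_0. pose proof (Rabs_pos c). split; [|lra].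
  apply Rmult_le_pos; [lra|]. apply Rlt_le, Rinv_0_lt_compat, lt_0_INR; lia.
Qed.

Lemma approximable_id : approximable 0 (fun z => z).
Proof.
  exists 1, O; split; [lra|].
  intros N HN; exists [0; 1]; split; [simpl; ring|].
  intros z Hz; simpl.
  replace (RtoC 0 + z * (RtoC 1 + z * RtoC 0) - z)%C with (RtoC 0) by ring.
  rewrite Cmod_0, (proj1 Hz). split; [|lra].
  apply Rmult_le_pos; [lra|]. apply Rlt_le, Rinv_0_lt_compat, lt_0_INR; lia.
Qed.

Lemma approximable_add c d G H : approximable c G -> approximable d H ->
  approximable (c + d) (fun z => (G z + H z)%C).
Proof.
  intros (K & m & HK & HG) (K' & m' & HK' & HH).
  exists (K + K'), (max m m'); split; [lra|].
  intros N HN.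
  destruct (HG N HN) as (p & Hp0 & Hp). destruct (HH N HN) as (q & Hq0 & Hq).
  exists (list_add p q); split; [rewrite peval_add, Hp0, Hq0, RtoC_plus; auto|].
  intros z Hz.
  destruct (Hp z Hz) as [A1 A2]. destruct (Hq z Hz) as [B1 B2].
  pose proof (blowup_pow_le z m (max m m') Hz (Nat.le_max_l _ _)).
  pose proof (blowup_pow_le z m' (max m m') Hz (Nat.le_max_r _ _)).
  set (Y := blowup z ^ max m m') in *.
  assert (HN0 : 0 < / INR N) by (apply Rinv_0_lt_compat, lt_0_INR; lia).
  assert (K * blowup z ^ m <= K * Y) by (apply Rmult_le_compat_l; auto).
  assert (K' * blowup z ^ m' <= K' * Y) by (apply Rmult_le_compat_l; auto).
  split.
  - rewrite peval_add.
    replace (peval p z + peval q z - (G z + H z))%C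
      with ((peval p z - G z) + (peval q z - H z))%C by ring.
    eapply Rle_trans; [apply Cmod_triangle|]. unfold Rdiv in *. nra.
  - eapply Rle_trans; [apply Cmod_triangle|]. lra.
Qed.

(** The error is [(p - G)(q - H) + (p - G) H + G (q - H)]. Each of the three terms is at most
    [u v / N], whence the factor 3; the growth bounds in [approximable] control the last two. *)
Lemma approximable_mul c d G H : approximable c G -> approximable d H ->
  approximable (c * d) (fun z => (G z * H z)%C).
Proof.
  intros (K & m & HK & HG) (K' & m' & HK' & HH).
  exists (3 * (K * K')), (m + m')%nat; split; [nra|].
  intros N HN.
  destruct (HG N HN) as (p & Hp0 & Hp). destruct (HH N HN) as (q & Hq0 & Hq).
  exists (list_mul p q); split; [rewrite peval_mul, Hp0, Hq0, RtoC_mult; auto|].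
  intros z Hz.
  destruct (Hp z Hz) as [A1 A2]. destruct (Hq z Hz) as [B1 B2].
  assert (HN0 : 0 < / INR N) by (apply Rinv_0_lt_compat, lt_0_INR; lia).
  assert (HN1 : / INR N <= 1).
  { rewrite <- Rinv_1. apply Rinv_le_contravar; [lra|]. apply (le_INR 1); auto. }
  rewrite pow_add. unfold Rdiv in *.
  set (u := K * blowup z ^ m) in *. set (v := K' * blowup z ^ m') in *.
  replace (3 * (K * K') * (blowup z ^ m * blowup z ^ m')) with (3 * (u * v))
    by (unfold u, v; ring).
  pose proof (Cmod_ge_0 (G z)). pose proof (Cmod_ge_0 (H z)).
  pose proof (Cmod_ge_0 (peval p z - G z)%C). pose proof (Cmod_ge_0 (peval q z - H z)%C).
  assert (0 <= u * v) by (apply Rmult_le_pos; lra).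
  split.
  - rewrite peval_mul.
    replace (peval p z * peval q z - G z * H z)%C
      with ((peval p z - G z) * (peval q z - H z) + (peval p z - G z) * H z
            + G z * (peval q z - H z))%C by ring.
    eapply Rle_trans; [apply Cmod_triangle|].
    eapply Rle_trans; [apply Rplus_le_compat_r, Cmod_triangle|].
    rewrite !Cmod_mult.
    assert (E1 : Cmod (peval p z - G z)%C * Cmod (peval q z - H z)%C
            <= (u * / INR N) * (v * / INR N)) by (apply Rmult_le_compat; auto).
    assert (E2 : Cmod (peval p z - G z)%C * Cmod (H z) <= (u * / INR N) * v)
      by (apply Rmult_le_compat; auto).
    assert (E3 : Cmod (G z) * Cmod (peval q z - H z)%C <= u * (v * / INR N))
      by (apply Rmult_le_compat; auto).
    assert (E4 : (u * / INR N) * (v * / INR N) <= (u * v) * / INR N).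
    { replace ((u * / INR N) * (v * / INR N)) with (((u * v) * / INR N) * / INR N) by ring.
      rewrite <- (Rmult_1_r (u * v * / INR N)) at 2.
      apply Rmult_le_compat_l; auto. apply Rmult_le_pos; lra. }
    lra.
  - rewrite Cmod_mult.
    assert (Cmod (G z) * Cmod (H z) <= u * v) by (apply Rmult_le_compat; auto). lra.
Qed.

Lemma approximable_pow c G n : approximable c G ->
  approximable (c ^ n) (fun z => (G z ^ n)%C).
Proof.
  intros HG; induction n as [|n IH]; simpl.
  - apply approximable_const.
  - apply (approximable_mul c (c ^ n) G (fun z => (G z ^ n)%C)); auto.
Qed.

(** * Cesaro means of the geometric series *)

Fixpoint cesaro (N : nat) : list R :=
  match N with
  | O => []
  | S n => list_add (repeat 1 (S n)) (cesaro n)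
  end.

Lemma peval_ones n z : ((RtoC 1 - z) * peval (repeat 1 n) z = RtoC 1 - z ^ n)%C.
Proof.
  induction n as [|n IH]; [simpl; ring|].
  cbn [repeat peval Cpow].
  transitivity ((RtoC 1 - z) + z * ((RtoC 1 - z) * peval (repeat 1 n) z))%C; [ring|].
  rewrite IH; ring.
Qed.

Lemma peval_ones_S n z : peval (repeat 1 (S n)) z = (peval (repeat 1 n) z + z ^ n)%C.
Proof.
  induction n as [|n IH]; [simpl; ring|].
  change (repeat 1 (S (S n))) with (1 :: repeat 1 (S n)).
  cbn [peval]. rewrite IH at 1. cbn [repeat peval Cpow]. ring.
Qed.

Lemma peval_cesaro N z :
  ((RtoC 1 - z) * peval (cesaro N) z = RtoC (INR N) - z * peval (repeat 1 N) z)%C.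
Proof.
  induction N as [|N IH]; [simpl; ring|].
  cbn [cesaro]. rewrite peval_add, Cmult_plus_distr_l, IH, peval_ones, peval_ones_S.
  rewrite S_INR, RtoC_plus. cbn [Cpow]. ring.
Qed.

(** The partial sums of the geometric series miss [W = 1/(1-z)] by [z^n W], which does not decay on
    the circle. Their averages miss it by [z (1 - z^N) W^2 / N], which is of order
    [blowup^2 / N]. *)
Lemma approximable_resolvent : approximable 1 (fun z => (/ (RtoC 1 - z))%C).
Proof.
  exists 1, 2%nat; split; [lra|].
  intros N HN. assert (HN0 : 0 < INR N) by (apply lt_0_INR; lia).
  exists (map (Rmult (/ INR N)) (cesaro N)); split.
  - rewrite peval_scal.
    pose proof (peval_cesaro N (RtoC 0)) as H.
    replace ((RtoC 1 - RtoC 0) * peval (cesaro N) (RtoC 0))%C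
      with (peval (cesaro N) (RtoC 0)) in H by ring.
    rewrite H, Cmult_0_l. rewrite <- RtoC_minus, <- RtoC_mult. f_equal. field. lra.
  - intros z Hz.
    pose proof (one_minus_neq0 z Hz) as Hne.
    pose proof (Cmod_one_minus_pos z Hz) as Hpos.
    pose proof (blowup_ge1 z Hz) as HY.
    assert (HW : Cmod (/ (RtoC 1 - z))%C = blowup z / 2).
    { rewrite Cmod_inv by auto. unfold blowup. field. lra. }
    rewrite HW. split; [|nra].
    assert (HNc : RtoC (INR N) <> RtoC 0) by (intros E; apply RtoC_inj in E; lra).
    replace (peval (map (Rmult (/ INR N)) (cesaro N)) z - / (RtoC 1 - z))%C
      with (RtoC (/ INR N) * (- (z * ((RtoC 1 - z ^ N)))) * (/ (RtoC 1 - z) * / (RtoC 1 - z)))%C.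
    + rewrite !Cmod_mult, Cmod_R, Cmod_opp, Cmod_mult, HW, (proj1 Hz).
      rewrite Rabs_pos_eq by (apply Rlt_le, Rinv_0_lt_compat; auto).
      pose proof (Cmod_one_minus_pow z N (proj1 Hz)).
      pose proof (Cmod_ge_0 (RtoC 1 - z ^ N)%C).
      assert (0 < / INR N) by (apply Rinv_0_lt_compat; auto).
      unfold Rdiv.
      apply Rle_trans with (/ INR N * (1 * 2) * (blowup z * / 2 * (blowup z * / 2))).
      * apply Rmult_le_compat_r; [nra|]. apply Rmult_le_compat_l; lra.
      * apply Rle_trans with (/ INR N * (blowup z * blowup z)); [|simpl; lra].
        nra.
    + rewrite peval_scal.
      replace (peval (cesaro N) z)
        with (/ (RtoC 1 - z) * ((RtoC 1 - z) * peval (cesaro N) z))%C by (field; auto).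
      rewrite peval_cesaro.
      replace (peval (repeat 1 N) z)
        with (/ (RtoC 1 - z) * ((RtoC 1 - z) * peval (repeat 1 N) z))%C by (field; auto).
      rewrite peval_ones, RtoC_inv by lra. field. split; auto.
Qed.

(** * The weight [exp (-1/|1-z|^2)] *)

Definition flat_exp (y : R) : R := if Rle_dec y 0 then 0 else exp (- / y).

Definition weight (z : Complex.C) : R := flat_exp (Cmod (RtoC 1 - z)%C * Cmod (RtoC 1 - z)%C).

Lemma flat_exp_nonneg y : 0 <= flat_exp y.
Proof. unfold flat_exp. destruct (Rle_dec y 0); [lra|]. apply Rlt_le, exp_pos. Qed.

Lemma flat_exp_le1 y : flat_exp y <= 1.
Proof.
  unfold flat_exp. destruct (Rle_dec y 0); [lra|].
  rewrite <- exp_0. assert (0 < / y) by (apply Rinv_0_lt_compat; lra).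
  apply Rlt_le, exp_increasing. lra.
Qed.

(** From [exp (1/y) >= 1/y]; this crude bound yields continuity at 0. *)
Lemma flat_exp_le y : 0 < y -> flat_exp y <= y.
Proof.
  intros Hy. unfold flat_exp. destruct (Rle_dec y 0); [lra|].
  pose proof (Rinv_0_lt_compat y Hy) as Hi.
  rewrite exp_Ropp. rewrite <- (Rinv_inv y) at 2.
  apply Rinv_le_contravar; auto. pose proof (exp_ineq1_le (/ y)). lra.
Qed.

Lemma Rcont_flat_exp : Rcont flat_exp.
Proof.
  intros y. destruct (Rlt_le_dec 0 y) as [Hy|Hy].
  - apply continuous_ext_loc with (fun y => exp (- / y)).
    + exists (mkposreal y Hy); intros w Hw.
      unfold ball in Hw; simpl in Hw; unfold AbsRing_ball, abs, minus, plus, opp in Hw; simpl in Hw.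
      apply Rabs_def2 in Hw. unfold flat_exp. destruct (Rle_dec w 0); auto; lra.
    + apply (ex_derive_continuous (fun y => exp (- / y))). auto_derive. lra.
  - assert (H0 : flat_exp y = 0) by (unfold flat_exp; destruct (Rle_dec y 0); auto; lra).
    unfold continuous. rewrite H0.
    apply filterlim_locally; intros eps. exists eps; intros w Hw.
    unfold ball in *; simpl in *; unfold AbsRing_ball, abs, minus, plus, opp in *; simpl in *.
    replace (flat_exp w + - 0) with (flat_exp w) by ring.
    rewrite Rabs_pos_eq by apply flat_exp_nonneg.
    destruct (Rlt_le_dec 0 w) as [Hw0|Hw0].
    + pose proof (flat_exp_le w Hw0). apply Rabs_def2 in Hw. lra.
    + unfold flat_exp. destruct (Rle_dec w 0); [apply cond_pos|lra].
Qed.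

(** With [u = x / (m + 1)] one has [u^m <= exp (m u) <= exp x]. Dividing by [m + 1] rather than [m]
    covers [m = 0]. *)
Lemma pow_exp_le x m : 0 <= x -> x ^ m * exp (- x) <= INR (S m) ^ m.
Proof.
  intros Hx. pose proof (lt_0_INR (S m) (Nat.lt_0_succ m)) as Hm.
  set (u := x / INR (S m)).
  assert (Hu : 0 <= u) by (apply Rmult_le_pos; [auto|apply Rlt_le, Rinv_0_lt_compat; auto]).
  assert (Hxu : x = INR (S m) * u) by (unfold u; field; lra).
  assert (Hpow : forall k, u ^ k <= exp (INR k * u)).
  { induction k as [|k IH]; [simpl; rewrite Rmult_0_l, exp_0; lra|].
    rewrite S_INR, Rmult_plus_distr_r, Rmult_1_l, Rplus_comm, exp_plus. simpl.
    apply Rmult_le_compat; auto; [apply pow_le; auto|].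
    pose proof (exp_ineq1_le u); lra. }
  assert (H1 : u ^ m <= exp x).
  { eapply Rle_trans; [apply Hpow|].
    destruct (Req_dec u 0) as [E|E].
    - rewrite Hxu, E, !Rmult_0_r. lra.
    - apply Rlt_le, exp_increasing. rewrite Hxu, S_INR. lra. }
  rewrite Hxu at 1. rewrite Rpow_mult_distr, Rmult_assoc.
  rewrite <- (Rmult_1_r (INR (S m) ^ m)) at 2.
  apply Rmult_le_compat_l; [apply pow_le; lra|].
  rewrite exp_Ropp. apply (Rmult_le_reg_r (exp x)); [apply exp_pos|].
  rewrite Rmult_assoc, Rinv_l, Rmult_1_r, Rmult_1_l; auto.
  pose proof (exp_pos x); lra.
Qed.

Definition res2 (z : Complex.C) : R := / (Cmod (RtoC 1 - z)%C * Cmod (RtoC 1 - z)%C).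

Lemma res2_pos z : on_circle z -> 0 < res2 z.
Proof.
  intros H. pose proof (Cmod_one_minus_pos z H). apply Rinv_0_lt_compat; nra.
Qed.

Lemma weight_exp z : on_circle z -> weight z = exp (- res2 z).
Proof.
  intros H. pose proof (Cmod_one_minus_pos z H). unfold weight, flat_exp.
  destruct (Rle_dec _ 0); auto. nra.
Qed.

Lemma weight_one : weight (RtoC 1) = 0.
Proof.
  unfold weight, flat_exp.
  replace (RtoC 1 - RtoC 1)%C with (RtoC 0) by ring. rewrite Cmod_0.
  destruct (Rle_dec _ 0); auto; lra.
Qed.

(** The weight beats every power of [1/|1-z|], so the rate [1/N] becomes uniform on the circle. Here
    [blowup^2 = 4 res2], and [M] bounds [K blowup^m] times the weight. *)
Lemma weighted_approximation c0 G d : approximable c0 G -> 0 < d -> exists p,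
  peval p (RtoC 0) = RtoC c0 /\
  forall z, on_circle z -> Cmod (peval p z - G z)%C * weight z <= d.
Proof.
  intros (K & m & HK & H) Hd.
  set (M := K * (4 ^ m * INR (S m) ^ m)).
  assert (HM : 0 <= M).
  { apply Rmult_le_pos; auto. apply Rmult_le_pos; apply pow_le; [lra|apply pos_INR]. }
  destruct (nfloor_ex (M / d)) as [N HN].
  { apply Rmult_le_pos; auto. apply Rlt_le, Rinv_0_lt_compat; auto. }
  destruct (H (S N)) as (p & Hp0 & Hp); [lia|].
  exists p; split; auto. intros z Hz.
  destruct (Hp z Hz) as [Hpz _].
  pose proof (res2_pos z Hz) as Hx. pose proof (blowup_ge1 z Hz) as HY.
  assert (HN0 : 0 < INR (S N)) by (apply lt_0_INR; lia).
  rewrite weight_exp by auto.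
  assert (HYm : blowup z ^ m <= 4 ^ m * res2 z ^ m).
  { rewrite <- Rpow_mult_distr.
    replace (4 * res2 z) with (blowup z ^ 2).
    - rewrite <- pow_mult. apply Rle_pow; auto; lia.
    - unfold blowup, res2. pose proof (Cmod_one_minus_pos z Hz). field. lra. }
  pose proof (pow_exp_le (res2 z) m (Rlt_le _ _ Hx)) as He.
  pose proof (exp_pos (- res2 z)) as Hep.
  apply Rle_trans with (M / INR (S N)).
  - apply Rle_trans with (K * blowup z ^ m / INR (S N) * exp (- res2 z)).
    + apply Rmult_le_compat_r; lra.
    + replace (K * blowup z ^ m / INR (S N) * exp (- res2 z))
        with (K * (blowup z ^ m * exp (- res2 z)) / INR (S N)) by (field; lra).
      apply Rmult_le_compat_r; [apply Rlt_le, Rinv_0_lt_compat; auto|].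
      apply Rmult_le_compat_l; auto.
      apply Rle_trans with (4 ^ m * res2 z ^ m * exp (- res2 z)).
      * apply Rmult_le_compat_r; lra.
      * rewrite Rmult_assoc. apply Rmult_le_compat_l; auto. apply pow_le; lra.
  - rewrite S_INR in *. apply (Rmult_le_reg_r (INR N + 1)); auto.
    unfold Rdiv. rewrite Rmult_assoc, Rinv_l, Rmult_1_r by lra.
    replace M with (M / d * d) by (field; lra). nra.
Qed.

(** * The resolvent on the circle and the two approximating polynomials *)

Lemma resolvent_parts z : on_circle z ->
  exists b, (/ (RtoC 1 - z))%C = (1 / 2, b) /\ res2 z = 1 / 4 + b * b.
Proof.
  intros Hz. pose proof (Cmod_one_minus_pos z Hz) as Hpos.
  destruct z as [a b]. destruct Hz as [Hm Hne].
  assert (Hab : a ^ 2 + b ^ 2 = 1).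
  { pose proof (Cmod2_alt (a, b)) as E. rewrite Hm in E. simpl Re in E; simpl Im in E. lra. }
  assert (HC : Cmod (RtoC 1 - (a, b))%C * Cmod (RtoC 1 - (a, b))%C = 2 - 2 * a).
  { pose proof (Cmod2_alt (RtoC 1 - (a, b))%C) as E. unfold Re, Im in E. simpl in E. nra. }
  assert (Ha : 0 < 2 - 2 * a) by nra.
  exists (b / (2 - 2 * a)). unfold res2. rewrite HC. split.
  - unfold Cinv; simpl.
    replace ((1 + - a) * ((1 + - a) * 1) + (0 + - b) * ((0 + - b) * 1)) with (2 - 2 * a)
      by nra.
    f_equal; field; lra.
  - replace (b / (2 - 2 * a) * (b / (2 - 2 * a)))
      with ((b * b) / ((2 - 2 * a) * (2 - 2 * a))) by (field; lra).
    replace (b * b) with ((1 - a) * (1 + a)) by nra. field. lra.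
Qed.

Lemma exp_nondecreasing a b : a <= b -> exp a <= exp b.
Proof.
  intros [H| ->]; [apply Rlt_le, exp_increasing; auto|lra].
Qed.

Lemma pow_1p_le_exp u n : 0 <= 1 + u -> (1 + u) ^ n <= exp (INR n * u).
Proof.
  intros Hu. induction n as [|n IH]; [simpl; rewrite Rmult_0_l, exp_0; lra|].
  replace (INR (S n) * u) with (u + INR n * u) by (rewrite S_INR; ring).
  rewrite exp_plus. simpl.
  apply Rmult_le_compat; auto; [apply pow_le; auto|apply exp_ineq1_le].
Qed.

(* [(1 + (W - 1)/s)^(s^2)] with [W = 1/(1-z)] mimics [exp (s (W - 1))], which
   equals 1 at 0 and has modulus [exp (-s/2)] on the circle. *)
Lemma weighted_null_polynomial d : 0 < d -> exists p,
  peval p (RtoC 0) = RtoC 1 /\ forall z, Cmod z = 1 -> Cmod (peval p z) * weight z <= d.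
Proof.
  intros Hd.
  destruct (nfloor_ex (2 / (d / 2))) as [s0 Hs0].
  { apply Rlt_le, Rdiv_lt_0_compat; lra. }
  set (s := S s0).
  assert (Hs : 0 < INR s) by (apply lt_0_INR; unfold s; lia).
  set (c := / INR s).
  assert (Hc : 0 < c) by (apply Rinv_0_lt_compat; auto).
  set (G := fun z => ((RtoC (1 - c) + RtoC c * / (RtoC 1 - z)) ^ (s * s))%C).
  assert (HG : approximable 1 G).
  { replace 1 with ((1 - c + c * 1) ^ (s * s))
      by (replace (1 - c + c * 1) with 1 by ring; apply pow1).
    apply (approximable_pow (1 - c + c * 1)
             (fun z => (RtoC (1 - c) + RtoC c * / (RtoC 1 - z))%C)).
    apply (approximable_add (1 - c) (c * 1) (fun _ => RtoC (1 - c))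
             (fun z => (RtoC c * / (RtoC 1 - z))%C)); [apply approximable_const|].
    apply (approximable_mul c 1 (fun _ => RtoC c)); [apply approximable_const|].
    apply approximable_resolvent. }
  destruct (weighted_approximation 1 G (d / 2) HG) as (p & Hp0 & Hp); [lra|].
  exists p; split; auto. intros z Hz1.
  destruct (classic (z = RtoC 1)) as [->|Hne].
  { rewrite weight_one, Rmult_0_r. lra. }
  assert (Hz : on_circle z) by (split; auto).
  specialize (Hp z Hz).
  assert (Hw0 : 0 <= weight z) by apply flat_exp_nonneg.
  assert (HGw : Cmod (G z) * weight z <= d / 2).
  { destruct (resolvent_parts z Hz) as (b & HW & Hx).
    (* With [Re W = 1/2] the linear term of the squared modulus is exactly [- c]. *)
    assert (Hm2 : Cmod (RtoC (1 - c) + RtoC c * / (RtoC 1 - z))%C ^ 2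
                  = 1 + (- c + c * c * res2 z)).
    { rewrite Cmod2_alt, HW, Hx. unfold Re, Im; simpl. field. }
    (* The power [s^2] turns the squared modulus into at most [exp (- s + res2 z)], and the squared
       weight contributes [exp (- 2 res2 z)]. *)
    assert (HG2 : (Cmod (G z) * weight z) ^ 2 <= exp (- INR s)).
    { unfold G.
      rewrite Cmod_pow, Rpow_mult_distr, <- pow_mult, (Nat.mul_comm (s * s)), pow_mult, Hm2.
      apply Rle_trans with (exp (INR (s * s) * (- c + c * c * res2 z)) * weight z ^ 2).
      - apply Rmult_le_compat_r; [apply pow_le; auto|]. apply pow_1p_le_exp.
        rewrite <- Hm2. apply pow2_ge_0.
      - rewrite weight_exp by auto.
        replace (exp (- res2 z) ^ 2) with (exp (- res2 z) * exp (- res2 z)) by ring.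
        rewrite <- !exp_plus.
        apply exp_nondecreasing. rewrite mult_INR. unfold c.
        replace (INR s * INR s * (- / INR s + / INR s * / INR s * res2 z))
          with (- INR s + res2 z) by (field; lra).
        pose proof (res2_pos z Hz). lra. }
    (* [s] exceeds [4 / d], hence [exp (s / 2) >= 1 + s / 2 > 2 / d]. *)
    assert (He : exp (- INR s) <= (d / 2) ^ 2).
    { apply Rle_trans with (exp (- (INR s / 2)) ^ 2).
      - simpl; rewrite Rmult_1_r, <- exp_plus. apply Req_le. f_equal. field.
      - apply pow_incr; split; [apply Rlt_le, exp_pos|].
        rewrite exp_Ropp.
        replace (d / 2) with (/ (2 / d)) by (field; lra).
        apply Rinv_le_contravar; [apply Rdiv_lt_0_compat; lra|].
        pose proof (exp_ineq1_le (INR s / 2)).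
        assert (2 / (d / 2) < INR s) by (unfold s; rewrite S_INR; lra).
        replace (2 / (d / 2)) with (2 * (2 / d)) in * by (field; lra). lra. }
    apply Rsqr_incr_0_var; [|lra]. unfold Rsqr. simpl in *. lra. }
  replace (peval p z) with ((peval p z - G z) + G z)%C by ring.
  apply Rle_trans with ((Cmod (peval p z - G z)%C + Cmod (G z)) * weight z).
  - apply Rmult_le_compat_r; auto. apply Cmod_triangle.
  - lra.
Qed.

Lemma exp_INR_mult n u : exp (INR n * u) = exp u ^ n.
Proof.
  induction n as [|n IH]; [simpl; rewrite Rmult_0_l, exp_0; auto|].
  replace (INR (S n) * u) with (u + INR n * u) by (rewrite S_INR; ring).
  rewrite exp_plus, IH; auto.
Qed.

Lemma Bernoulli_le v n : 0 <= v <= 1 -> 1 - INR n * v <= (1 - v) ^ n.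
Proof.
  intros Hv; induction n as [|n IH]; [simpl; lra|].
  rewrite S_INR; simpl.
  apply Rle_trans with ((1 - v) * (1 - INR n * v)).
  - pose proof (pos_INR n). assert (0 <= INR n * (v * v)) by (apply Rmult_le_pos; nra). nra.
  - apply Rmult_le_compat_l; lra.
Qed.

(** With [u = x / n] the product is [((1 + u) exp (- u))^n], which lies between [(1 - u^2)^n] and 1
    when [u <= 1]; Bernoulli then bounds the deficit by [n u^2]. If [n u^2 >= 1] the trivial bound 1
    is enough. *)
Lemma exp_deficit x n : 0 <= x -> (1 <= n)%nat ->
  0 <= 1 - (1 + x / INR n) ^ n * exp (- x) <= 1 /\
  1 - (1 + x / INR n) ^ n * exp (- x) <= x * x / INR n.
Proof.
  intros Hx Hn.
  assert (Hn0 : 1 <= INR n) by (apply (le_INR 1); auto).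
  set (u := x / INR n).
  assert (Hu : 0 <= u) by (apply Rmult_le_pos; [auto|apply Rlt_le, Rinv_0_lt_compat; lra]).
  assert (Hxu : x = INR n * u) by (unfold u; field; lra).
  assert (Hth : (1 + u) ^ n * exp (- x) = ((1 + u) * exp (- u)) ^ n).
  { rewrite Rpow_mult_distr. f_equal. rewrite Hxu at 1.
    rewrite <- exp_INR_mult. f_equal; ring. }
  assert (H1 : (1 + u) ^ n * exp (- x) <= 1).
  { apply Rle_trans with (exp x * exp (- x)).
    - apply Rmult_le_compat_r; [apply Rlt_le, exp_pos|].
      rewrite Hxu. apply pow_1p_le_exp; lra.
    - rewrite <- exp_plus. replace (x + - x) with 0 by ring. rewrite exp_0; lra. }
  assert (H0 : 0 <= (1 + u) ^ n * exp (- x)).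
  { apply Rmult_le_pos; [apply pow_le; lra|apply Rlt_le, exp_pos]. }
  split; [lra|].
  replace (x * x / INR n) with (INR n * (u * u)) by (rewrite Hxu; field; lra).
  destruct (Rle_dec 1 (INR n * (u * u))) as [Hb|Hb]; [lra|].
  assert (Huu : u * u <= 1) by nra.
  rewrite Hth.
  apply Rle_trans with (1 - (1 - u * u) ^ n).
  - apply Rplus_le_compat_l, Ropp_le_contravar, pow_incr; split; [lra|].
    pose proof (exp_ineq1_le (- u)). nra.
  - pose proof (Bernoulli_le (u * u) n). nra.
Qed.

(** Since [z = 1 - 1/W], the left side is [W (1 - W)], and [1 - W] is the conjugate of [W] because
    [Re W = 1/2]. *)
Lemma resolvent_square z : on_circle z ->
  (- (z * (/ (RtoC 1 - z) * / (RtoC 1 - z))))%C = RtoC (res2 z).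
Proof.
  intros Hz. pose proof (one_minus_neq0 z Hz) as Hne.
  destruct (resolvent_parts z Hz) as (b & HW & Hx).
  transitivity (/ (RtoC 1 - z) - / (RtoC 1 - z) * / (RtoC 1 - z))%C.
  - field; auto.
  - rewrite HW, Hx. unfold RtoC, Cminus, Cplus, Copp, Cmult; simpl. f_equal; field.
Qed.

(* [1/weight = exp (|W|^2)] and [|W|^2 = - z W^2] is rational in [z], so the
   powers [(1 - z W^2 / n)^n] approximate the inverse of the weight. *)
Lemma weighted_one_minus_z d : 0 < d -> exists p, forall z, Cmod z = 1 ->
  Cmod (peval p z * RtoC (weight z) - (RtoC 1 - z))%C <= d.
Proof.
  intros Hd.
  (* [X] is the threshold for [res2 z]: from there on [|1-z| <= d / 2], and below it the choice
     [n >= X^2] makes the deficit small. *)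
  set (X := 4 / (d * d)).
  assert (HX : 0 < X) by (apply Rdiv_lt_0_compat; nra).
  destruct (nfloor_ex (X * X)) as [n0 Hn0]; [nra|].
  set (n := S n0).
  assert (Hn : X * X <= INR n) by (unfold n; rewrite S_INR; lra).
  assert (Hn1 : 1 <= INR n) by (apply (le_INR 1); unfold n; lia).
  set (G := fun z => ((RtoC 1 + RtoC (-1) * z) *
    (RtoC 1 + RtoC (- / INR n) * (z * (/ (RtoC 1 - z) * / (RtoC 1 - z)))) ^ n)%C).
  assert (HG : approximable ((1 + -1 * 0) * (1 + - / INR n * (0 * (1 * 1))) ^ n) G).
  { apply (approximable_mul (1 + -1 * 0) _ (fun z => RtoC 1 + RtoC (-1) * z)%C).
    - apply (approximable_add 1 (-1 * 0) (fun _ => RtoC 1)); [apply approximable_const|].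
      apply (approximable_mul (-1) 0 (fun _ => RtoC (-1)) (fun z => z));
        [apply approximable_const|apply approximable_id].
    - apply (approximable_pow _ (fun z => (RtoC 1 + RtoC (- / INR n) *
               (z * (/ (RtoC 1 - z) * / (RtoC 1 - z))))%C)).
      apply (approximable_add 1 _ (fun _ => RtoC 1)); [apply approximable_const|].
      apply (approximable_mul (- / INR n) _ (fun _ => RtoC (- / INR n)));
        [apply approximable_const|].
      apply (approximable_mul 0 _ (fun z => z)); [apply approximable_id|].
      apply approximable_mul; apply approximable_resolvent. }
  destruct (weighted_approximation _ G (d / 2) HG) as (p & _ & Hp); [lra|].
  exists p. intros z Hz1.
  destruct (classic (z = RtoC 1)) as [->|Hne].
  { rewrite weight_one.
    replace (peval p (RtoC 1) * RtoC 0 - (RtoC 1 - RtoC 1))%C with (RtoC 0) by ring.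
    rewrite Cmod_0; lra. }
  assert (Hz : on_circle z) by (split; auto).
  specialize (Hp z Hz).
  assert (Hw0 : 0 <= weight z) by apply flat_exp_nonneg.
  pose proof (res2_pos z Hz) as Hx.
  destruct (exp_deficit (res2 z) n) as [[D0 D1] D2]; [lra|unfold n; lia|].
  set (D := 1 - (1 + res2 z / INR n) ^ n * exp (- res2 z)) in *.
  assert (HGz : (G z * RtoC (weight z) - (RtoC 1 - z) = RtoC (- D) * (RtoC 1 - z))%C).
  { unfold G.
    replace (RtoC (- / INR n) * (z * (/ (RtoC 1 - z) * / (RtoC 1 - z))))%C
      with (RtoC (/ INR n) * (- (z * (/ (RtoC 1 - z) * / (RtoC 1 - z)))))%C
      by (rewrite RtoC_opp; ring).
    rewrite resolvent_square, <- RtoC_mult, <- RtoC_plus, <- RtoC_pow by auto.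
    rewrite weight_exp by auto. unfold D.
    rewrite RtoC_opp, RtoC_minus, RtoC_mult.
    replace (1 + / INR n * res2 z) with (1 + res2 z / INR n) by (unfold Rdiv; ring).
    replace (RtoC (-1)) with (- RtoC 1)%C by (apply injective_projections; simpl; ring).
    ring. }
  assert (HGd : Cmod (G z * RtoC (weight z) - (RtoC 1 - z))%C <= d / 2).
  { rewrite HGz, Cmod_mult, Cmod_R, Rabs_Ropp, Rabs_pos_eq by auto.
    pose proof (Cmod_one_minus_pos z Hz) as Hpos.
    apply Rsqr_incr_0_var; [|lra]. unfold Rsqr.
    replace (D * Cmod (RtoC 1 - z)%C * (D * Cmod (RtoC 1 - z)%C))
      with (D * D / res2 z) by (unfold res2; field; lra).
    apply (Rmult_le_reg_r (res2 z)); auto.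
    unfold Rdiv at 1. rewrite Rmult_assoc, Rinv_l, Rmult_1_r by lra.
    assert (Hdx : d / 2 * (d / 2) * X = 1) by (unfold X; field; lra).
    (* Near 1 the bound [D <= 1] suffices; away from 1 the bound [D <= (res2 z)^2 / n] is used. *)
    destruct (Rle_dec X (res2 z)) as [Hc|Hc].
    - apply Rle_trans with 1; [nra|]. rewrite <- Hdx.
      apply Rmult_le_compat_l; nra.
    - apply Rle_trans with (res2 z * res2 z / INR n); [nra|].
      apply (Rmult_le_reg_r (INR n)); [lra|].
      unfold Rdiv at 1. rewrite Rmult_assoc, Rinv_l, Rmult_1_r by lra.
      apply Rle_trans with (d / 2 * (d / 2) * res2 z * (X * X)).
      + replace (d / 2 * (d / 2) * res2 z * (X * X))
          with (d / 2 * (d / 2) * X * (res2 z * X)) by ring.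
        rewrite Hdx. nra.
      + apply Rmult_le_compat_l; auto.
        apply Rmult_le_pos; [nra|lra]. }
  replace (peval p z * RtoC (weight z) - (RtoC 1 - z))%C
    with ((peval p z - G z) * RtoC (weight z)
          + (G z * RtoC (weight z) - (RtoC 1 - z)))%C by ring.
  eapply Rle_trans; [apply Cmod_triangle|].
  rewrite Cmod_mult, Cmod_R, (Rabs_pos_eq (weight z)) by auto. lra.
Qed.

(** * A cyclic vector of the bilateral shift *)

Definition bshift (b : Z -> R) : Z -> R := fun k => b (k + 1)%Z.

Definition basis {V : Type} (v : V) : V -> R :=
  fun w => if excluded_middle_informative (w = v) then 1 else 0.

Definition circ (t : R) : Complex.C := (cos t, sin t).

Lemma Cmod_circ t : Cmod (circ t) = 1.
Proof.
  unfold Cmod, circ; simpl. rewrite !Rmult_1_r, Rplus_comm.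
  pose proof (sin2_cos2 t) as E; unfold Rsqr in E. rewrite E. apply sqrt_1.
Qed.

Definition wfun (t : R) : Complex.C := (weight (circ t), 0).

Lemma Ccont_wfun : Ccont wfun.
Proof.
  split; simpl; [|apply Rcont_const].
  apply Rcont_ext with (fun t => flat_exp (2 - 2 * cos (1 * t))).
  - intros t. unfold weight. f_equal.
    pose proof (Cmod2_alt (RtoC 1 - circ t)%C) as E. unfold Re, Im in E; simpl in E.
    pose proof (sin2_cos2 t) as E2; unfold Rsqr in E2. rewrite Rmult_1_l. nra.
  - intros t. apply (continuous_comp (fun t => 2 - 2 * cos (1 * t)) flat_exp).
    + assert (Rcont (fun t => 2 - 2 * cos (1 * t))) by auto with rcont. auto.
    + apply Rcont_flat_exp.
Qed.

Lemma Ccont_circ_mul F : Ccont F -> Ccont (fun t => (circ t * F t)%C).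
Proof.
  intros [H1 H2].
  assert (Hc : Rcont cos)
    by (apply Rcont_ext with (fun t => cos (1 * t)); auto with rcont; intros; f_equal; ring).
  assert (Hs : Rcont sin)
    by (apply Rcont_ext with (fun t => sin (1 * t)); auto with rcont; intros; f_equal; ring).
  split; simpl; auto with rcont.
Qed.

Lemma fcoef_circ_mul F m : fcoef (fun t => (circ t * F t)%C) m = fcoef F (m - 1).
Proof.
  apply avg_ext; intros t; simpl.
  replace (IZR (m - 1) * t) with (IZR m * t - t) by (rewrite minus_IZR; ring).
  rewrite cos_minus, sin_minus. ring.
Qed.

(** Fourier coefficients turn multiplication by [z] into [bshift]. Continuity is carried through the
    induction because additivity of [fcoef] depends on it. *)
Lemma poly_app_fcoef p F : Ccont F ->
  Ccont (fun t => (peval p (circ t) * F t)%C) /\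
  poly_app bshift p (fun k => fcoef F (- k)) =
    fun k => fcoef (fun t => (peval p (circ t) * F t)%C) (- k).
Proof.
  revert F; induction p as [|c p IH]; intros F HF.
  - split.
    + split; [apply Rcont_ext with (fun _ => 0)|apply Rcont_ext with (fun _ => 0)];
        try apply Rcont_const; intros; simpl; ring.
    + simpl; apply functional_extensionality; intros k. unfold vzero, fcoef.
      transitivity (avg (fun _ => 0)); [symmetry; apply avg_const|].
      apply avg_ext; intros; simpl; ring.
  - destruct (IH (fun t => (circ t * F t)%C)) as [HC HE]; [apply Ccont_circ_mul; auto|].
    assert (Heq : forall t, (peval (c :: p) (circ t) * F t)%C =
       (c * fst (F t) + fst (peval p (circ t) * (circ t * F t))%C,
        c * snd (F t) + snd (peval p (circ t) * (circ t * F t))%C)).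
    { intros t. cbn [peval]. apply injective_projections; simpl; ring. }
    split.
    + destruct (Ccont_axpy c _ _ HF HC) as [A1 A2].
      split; [eapply Rcont_ext; [|apply A1]|eapply Rcont_ext; [|apply A2]];
        intros t; rewrite Heq; auto.
    + cbn [poly_app].
      replace (bshift (fun k => fcoef F (- k)))
        with (fun k => fcoef (fun t => (circ t * F t)%C) (- k)).
      * rewrite HE. apply functional_extensionality; intros k.
        rewrite (fcoef_ext _ _ (- k) Heq), fcoef_axpy by auto. reflexivity.
      * apply functional_extensionality; intros k. unfold bshift.
        rewrite fcoef_circ_mul. f_equal. lia.
Qed.

Lemma norm_le_fcoef_Cmod F d : 0 <= d -> Ccont F -> (forall t, Cmod (F t) <= d) ->
  norm_le (fun k => fcoef F (- k)) d.
Proof.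
  intros Hd HF H. apply norm_le_fcoef; auto. intros t.
  pose proof (Cmod2_alt (F t)) as E. unfold Re, Im in E.
  pose proof (Cmod_ge_0 (F t)). specialize (H t). nra.
Qed.

Definition cyc_seq : Z -> R := fun k => fcoef wfun (- k).

Lemma cyc_seq_l2 : l2 cyc_seq.
Proof.
  exists 1. unfold cyc_seq. apply norm_le_fcoef; [lra|apply Ccont_wfun|].
  intros t; unfold wfun, weight; simpl.
  set (y := Cmod (1 - circ t)%C * Cmod (1 - circ t)%C).
  pose proof (flat_exp_nonneg y). pose proof (flat_exp_le1 y). nra.
Qed.

Lemma cyc_seq_null d : 0 < d -> exists p, norm_le (poly_app bshift (1 :: p) cyc_seq) d.
Proof.
  intros Hd. destruct (weighted_null_polynomial d Hd) as (p & Hp0 & Hp).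
  destruct p as [|c p].
  { simpl in Hp0. apply RtoC_inj in Hp0. lra. }
  assert (Hc : c = 1).
  { simpl in Hp0. apply RtoC_inj. rewrite <- Hp0. ring. }
  subst c. exists p.
  destruct (poly_app_fcoef (1 :: p) wfun Ccont_wfun) as [HC HE].
  unfold cyc_seq; rewrite HE. apply norm_le_fcoef_Cmod; auto; [lra|].
  intros t. rewrite Cmod_mult.
  change (wfun t) with (RtoC (weight (circ t))).
  rewrite Cmod_R, Rabs_pos_eq by apply flat_exp_nonneg.
  apply Hp, Cmod_circ.
Qed.

(** The coefficients of [p] times the weight are close to those of [1 - z]; by the sign convention
    the monomial [z] sits at index [-1]. *)
Lemma cyc_seq_increment d : 0 < d -> exists p,
  norm_le (vdiff (poly_app bshift p cyc_seq) (vdiff (basis 0%Z) (basis (-1)%Z))) d.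
Proof.
  intros Hd. destruct (weighted_one_minus_z d Hd) as (p & Hp). exists p.
  destruct (poly_app_fcoef p wfun Ccont_wfun) as [HC HE].
  unfold cyc_seq; rewrite HE.
  set (F := fun t => (peval p (circ t) * wfun t)%C) in *.
  set (E := fun k t => (cos (IZR k * t), sin (IZR k * t))).
  set (H := fun t => (-1 * fst (E 0%Z t) + fst (F t), -1 * snd (E 0%Z t) + snd (F t))).
  set (D := fun t => (1 * fst (E 1%Z t) + fst (H t), 1 * snd (E 1%Z t) + snd (H t))).
  assert (HC1 : Ccont H) by (apply Ccont_axpy; auto; apply Ccont_exp).
  assert (HD : Ccont D) by (apply (Ccont_axpy 1 (E 1%Z)); auto; apply Ccont_exp).
  replace (vdiff _ _) with (fun k => fcoef D (- k)).
  - apply norm_le_fcoef_Cmod; auto; [lra|]. intros t.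
    replace (D t) with (peval p (circ t) * RtoC (weight (circ t)) - (RtoC 1 - circ t))%C.
    + apply Hp, Cmod_circ.
    + unfold D, H, E, F. cbn [fst snd]. rewrite Rmult_0_l, cos_0, sin_0, !Rmult_1_l.
      apply injective_projections; simpl; ring.
  - apply functional_extensionality; intros k. unfold D.
    rewrite (fcoef_axpy 1 (E 1%Z)) by (auto; apply Ccont_exp).
    unfold H; rewrite fcoef_axpy by (auto; apply Ccont_exp).
    unfold E; rewrite !fcoef_exp. unfold vdiff, basis.
    destruct (excluded_middle_informative (k = 0%Z)), (excluded_middle_informative (k = (-1)%Z)),
      (Z.eq_dec 1 (- k)), (Z.eq_dec 0 (- k)); try lia; ring.
Qed.

Lemma basis_same {V : Type} (v : V) : basis v v = 1.
Proof. unfold basis; destruct (excluded_middle_informative (v = v)); tauto. Qed.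

Lemma basis_other {V : Type} (v w : V) : w <> v -> basis v w = 0.
Proof. intros; unfold basis; destruct (excluded_middle_informative (w = v)); tauto. Qed.

Lemma norm_le_basis {V : Type} (v : V) : norm_le (basis v) 1.
Proof.
  split; [lra|]. intros L HL.
  destruct (classic (In v L)) as [Hv|Hv].
  - rewrite (Rsum_list_single _ L v); auto; [rewrite basis_same; lra|].
    intros w _ Hw; rewrite basis_other by auto; ring.
  - rewrite Rsum_list_zero; [lra|]. intros w Hw.
    rewrite basis_other by congruence; ring.
Qed.

Definition translate (n : Z) (b : Z -> R) : Z -> R := fun k => b (k + n)%Z.

Lemma translate_norm n b r : norm_le b r -> norm_le (translate n b) r.
Proof.
  intros [H0 H]; split; auto. intros L HL.
  replace (Rsum_list _ L)
    with (Rsum_list (fun k => b k * b k) (map (fun k => (k + n)%Z) L)).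
  - apply H, Injective_map_NoDup; auto. intros i j; lia.
  - clear HL; induction L as [|a L IH]; simpl; auto. rewrite IH; auto.
Qed.

Lemma translate_bshift n b : bshift (translate n b) = translate n (bshift b).
Proof.
  apply functional_extensionality; intros k; unfold bshift, translate. f_equal; lia.
Qed.

Lemma translate_poly_app n p b :
  poly_app bshift p (translate n b) = translate n (poly_app bshift p b).
Proof.
  revert b; induction p as [|c p IH]; intros b; simpl; auto.
  rewrite translate_bshift, IH; auto.
Qed.

Lemma translate_basis n m : translate n (basis m) = basis (m - n)%Z.
Proof.
  apply functional_extensionality; intros k; unfold translate, basis.
  destruct (excluded_middle_informative (k + n = m)%Z),
    (excluded_middle_informative (k = m - n)%Z); auto; lia.
Qed.

(** This is [e_(m-1) + ... + e_(m-N)], whose norm grows only like [sqrt N]. *)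
Fixpoint block (m : Z) (N : nat) : Z -> R :=
  match N with
  | O => vzero
  | S n => vadd (block m n) (basis (m - Z.of_nat (S n))%Z)
  end.

Lemma block_support m N k : (k < m - Z.of_nat N)%Z -> block m N k = 0.
Proof.
  induction N as [|N IH]; intros Hk; [reflexivity|].
  cbn [block]; unfold vadd. rewrite IH by lia. rewrite basis_other by lia. ring.
Qed.

Lemma block_norm m N : norm_le (block m N) (sqrt (INR N)).
Proof.
  split; [apply sqrt_pos|]. intros L HL. rewrite sqrt_sqrt by apply pos_INR.
  induction N as [|N IH].
  - rewrite Rsum_list_zero; [simpl; lra|]. intros; simpl; unfold vzero; ring.
  - rewrite (Rsum_list_ext _ (fun k => block m N k * block m N k
      + basis (m - Z.of_nat (S N))%Z k * basis (m - Z.of_nat (S N))%Z k)).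
    + rewrite Rsum_list_plus, S_INR.
      pose proof (proj2 (norm_le_basis (m - Z.of_nat (S N))%Z) L HL). lra.
    + intros k _. cbn [block]; unfold vadd.
      destruct (Z.eq_dec k (m - Z.of_nat (S N))) as [->|Hk].
      * rewrite block_support by lia. ring.
      * rewrite basis_other by auto. ring.
Qed.

(** * Transfer through a bounded map intertwining [T] with the bilateral shift *)

Section Embedding.
Context {V : Type}.
Variable T : (V -> R) -> V -> R.
Hypothesis HT : linear_contraction T.
Variables (J : (Z -> R) -> V -> R) (K : R).
Hypothesis J_lin : forall a b c, J (vadd (vscal a b) c) = vadd (vscal a (J b)) (J c).
Hypothesis J_norm : forall b r, norm_le b r -> norm_le (J b) (K * r).
Hypothesis J_bshift : forall b, T (J b) = J (bshift b).

Lemma embed_zero : J vzero = vzero.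
Proof.
  replace (@vzero Z) with (vadd (vscal (-1) (@vzero Z)) vzero) at 1 by vext.
  rewrite J_lin; vext.
Qed.

Lemma embed_diff b c : J (vdiff b c) = vdiff (J b) (J c).
Proof.
  replace (vdiff b c) with (vadd (vscal (-1) c) b) by vext. rewrite J_lin; vext.
Qed.

Lemma embed_poly_app p b : J (poly_app bshift p b) = poly_app T p (J b).
Proof.
  revert b; induction p as [|c p IH]; intros b; simpl; [apply embed_zero|].
  rewrite J_lin, IH, J_bshift; auto.
Qed.

Lemma embed_l2 b : l2 b -> l2 (J b).
Proof. intros [r H]; eexists; apply J_norm; eauto. Qed.

Lemma embed_closed x b : 0 <= K ->
  (forall d, 0 < d -> exists c, in_cyclic_span T x (J c) /\ norm_le (vdiff c b) d) ->
  in_cyclic_span T x (J b).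
Proof.
  intros HK H. apply cyclic_span_closed; intros d Hd.
  destruct (H (d / (K + 1))) as (c & Hc & Hn); [apply Rdiv_lt_0_compat; lra|].
  exists (J c); split; auto. rewrite <- embed_diff.
  eapply norm_le_weaken; [apply J_norm; eauto|].
  apply (Rmult_le_reg_r (K + 1)); [lra|].
  replace (K * (d / (K + 1)) * (K + 1)) with (K * d) by (field; lra). nra.
Qed.

Lemma embed_null d : 0 <= K -> 0 < d ->
  exists p, norm_le (poly_app T (1 :: p) (J cyc_seq)) d.
Proof.
  intros HK Hd.
  destruct (cyc_seq_null (d / (K + 1))) as [p Hp]; [apply Rdiv_lt_0_compat; lra|].
  exists p. rewrite <- embed_poly_app.
  eapply norm_le_weaken; [apply J_norm; eauto|].
  apply (Rmult_le_reg_r (K + 1)); [lra|].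
  replace (K * (d / (K + 1)) * (K + 1)) with (K * d) by (field; lra). nra.
Qed.

(** First all translates of [cyc_seq], backward ones included, are reached; they give the
    differences of neighbouring basis vectors, and averaging isolates [basis m]. *)
Lemma embed_basis_in_span x m : 0 <= K -> l2 x ->
  in_cyclic_span T x (J cyc_seq) -> in_cyclic_span T x (J (basis m)).
Proof.
  intros HK Hx H.
  assert (Hl2 : forall n, l2 (translate n cyc_seq)).
  { intros n. destruct cyc_seq_l2 as [r Hr]. exists r; apply translate_norm; auto. }
  (* The shift is inverted inside the span: if [b] is the shift of [b'] and [b' + p(bshift) b] is
     small, then [b'] is close to [- p(bshift) b]. This is where constant term 1 is used. *)
  assert (Hneg : forall j : nat, in_cyclic_span T x (J (translate (- Z.of_nat j) cyc_seq))).
  { induction j as [|j IH].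
    - replace (translate _ _) with cyc_seq; auto.
      apply functional_extensionality; intros k; unfold translate; f_equal; simpl; lia.
    - apply embed_closed; auto. intros d Hd.
      destruct (cyc_seq_null d Hd) as [p Hp].
      set (b := translate (- Z.of_nat j) cyc_seq) in *.
      exists (vscal (-1) (poly_app bshift p b)); split.
      + replace (vscal (-1) (poly_app bshift p b))
          with (vadd (vscal (-1) (poly_app bshift p b)) vzero) by vext.
        rewrite J_lin, embed_zero, embed_poly_app.
        apply cyclic_span_add; auto using cyclic_span_zero.
        apply cyclic_span_scal, cyclic_span_poly_app; auto.
        apply embed_l2, Hl2.
      + apply (translate_norm (- Z.of_nat (S j))) in Hp.
        rewrite <- translate_poly_app in Hp. cbn [poly_app] in Hp.
        replace (bshift (translate (- Z.of_nat (S j)) cyc_seq)) with b in Hp.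
        * apply (norm_le_scal (-1)) in Hp. 
          replace (Rabs (-1) * d) with d in Hp by (rewrite Rabs_left by lra; ring).
          replace (vdiff _ _) with (vscal (-1) (vadd
            (vscal 1 (translate (- Z.of_nat (S j)) cyc_seq)) (poly_app bshift p b))); auto.
          vext.
        * apply functional_extensionality; intros k; unfold b, bshift, translate; f_equal; lia. }
  assert (Hall : forall n, in_cyclic_span T x (J (translate n cyc_seq))).
  { intros n. destruct (Z.le_gt_cases n 0) as [Hn|Hn].
    - replace n with (- Z.of_nat (Z.to_nat (- n)))%Z by lia. apply Hneg.
    - assert (Hpos : forall j : nat, in_cyclic_span T x (J (translate (Z.of_nat j) cyc_seq))).
      { induction j as [|j IH]; [apply (Hneg O)|].
        replace (translate (Z.of_nat (S j)) cyc_seq)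
          with (bshift (translate (Z.of_nat j) cyc_seq)).
        - rewrite <- J_bshift. apply cyclic_span_op; auto. apply embed_l2, Hl2.
        - apply functional_extensionality; intros k; unfold bshift, translate; f_equal; lia. }
      replace n with (Z.of_nat (Z.to_nat n)) by lia. apply Hpos. }
  assert (Hinc : forall i, in_cyclic_span T x (J (vdiff (basis i) (basis (i - 1)%Z)))).
  { intros i. apply embed_closed; auto. intros d Hd.
    destruct (cyc_seq_increment d Hd) as [p Hp].
    exists (poly_app bshift p (translate (- i) cyc_seq)); split.
    - rewrite embed_poly_app. apply cyclic_span_poly_app; auto. apply embed_l2, Hl2.
    - apply (translate_norm (- i)) in Hp. rewrite translate_poly_app.
      replace (vdiff (basis i) (basis (i - 1)%Z)) with
        (translate (- i) (vdiff (basis 0%Z) (basis (-1)%Z))); auto.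
      change (translate (- i) (vdiff (basis 0%Z) (basis (-1)%Z)))
        with (vdiff (translate (- i) (basis 0%Z)) (translate (- i) (basis (-1)%Z))).
      rewrite !translate_basis. f_equal; f_equal; lia. }
  assert (Hfar : forall N : nat,
    in_cyclic_span T x (J (vdiff (basis m) (basis (m - Z.of_nat N)%Z)))).
  { induction N as [|N IH].
    - replace (m - Z.of_nat 0)%Z with m by lia.
      replace (vdiff _ _) with (@vzero Z) by vext. rewrite embed_zero. apply cyclic_span_zero.
    - replace (vdiff (basis m) _) with (vadd (vscal 1 (vdiff (basis m) (basis (m - Z.of_nat N)%Z)))
        (vdiff (basis (m - Z.of_nat N)%Z) (basis (m - Z.of_nat N - 1)%Z))).
      + rewrite J_lin. apply cyclic_span_add; auto. apply cyclic_span_scal; auto.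
      + replace (m - Z.of_nat (S N))%Z with (m - Z.of_nat N - 1)%Z by lia. vext. }
  (* Summing the differences [e_m - e_(m-j)] for [j = 1, ..., N]. *)
  assert (Hblock : forall N : nat,
    in_cyclic_span T x (J (vdiff (vscal (INR N) (basis m)) (block m N)))).
  { induction N as [|N IH].
    - replace (vdiff _ _) with (@vzero Z) by (simpl; vext).
      rewrite embed_zero. apply cyclic_span_zero.
    - replace (vdiff _ _) with (vadd (vscal 1 (vdiff (vscal (INR N) (basis m)) (block m N)))
        (vdiff (basis m) (basis (m - Z.of_nat (S N))%Z))).
      + rewrite J_lin. apply cyclic_span_add; auto. apply cyclic_span_scal; auto.
      + cbn [block]. rewrite S_INR. vext. }
  apply embed_closed; auto. intros d Hd.
  destruct (nfloor_ex (/ (d * d))) as [N0 HN0].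
  { apply Rlt_le, Rinv_0_lt_compat; nra. }
  set (N := S N0).
  assert (HN : 0 < INR N) by (apply lt_0_INR; unfold N; lia).
  (* This average differs from [basis m] by [block m N / N], of norm at most [1 / sqrt N <= d]. *)
  exists (vscal (/ INR N) (vdiff (vscal (INR N) (basis m)) (block m N))); split.
  - replace (vscal (/ INR N) _) with
      (vadd (vscal (/ INR N) (vdiff (vscal (INR N) (basis m)) (block m N))) vzero) by vext.
    rewrite J_lin, embed_zero.
    apply cyclic_span_add; auto using cyclic_span_zero. apply cyclic_span_scal; auto.
  - replace (vdiff _ _) with (vscal (- / INR N) (block m N)).
    2:{ vext. field. lra. }
    eapply norm_le_weaken; [apply norm_le_scal, block_norm|].
    rewrite Rabs_Ropp, Rabs_pos_eq by (apply Rlt_le, Rinv_0_lt_compat; auto).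
    pose proof (sqrt_lt_R0 _ HN) as Hs. pose proof (sqrt_sqrt _ (Rlt_le _ _ HN)) as Hss.
    replace (/ INR N * sqrt (INR N)) with (/ sqrt (INR N))
      by (rewrite <- Hss at 2; field; lra).
    rewrite <- (Rinv_inv d). apply Rinv_le_contravar; [apply Rinv_0_lt_compat; auto|].
    apply Rsqr_incr_0_var; [|lra]. unfold Rsqr. rewrite Hss.
    rewrite <- Rinv_mult. unfold N; rewrite S_INR; lra.
Qed.

End Embedding.

(** * From real to complex vectors *)

Definition cembed {V : Type} (x : V -> R) : V -> Defs.C := fun v => (x v, 0).

Lemma norm2_le_cembed {V : Type} (x : V -> R) r :
  norm_le x r -> norm2_le (cembed x) (r * r).
Proof.
  intros [H0 H] L HL. eapply Rle_trans; [|apply (H L HL)].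
  apply Rsum_list_le; intros v _; unfold cembed, Cnorm2; simpl; lra.
Qed.

Lemma l2_parts {V : Type} (y : V -> Defs.C) : in_l2 y ->
  l2 (fun v => fst (y v)) /\ l2 (fun v => snd (y v)).
Proof.
  intros [c Hc].
  assert (Hc0 : 0 <= c) by (specialize (Hc [] (NoDup_nil V)); simpl in Hc; auto).
  split; exists (sqrt c); split; try apply sqrt_pos; intros L HL;
    rewrite sqrt_sqrt by auto; eapply Rle_trans; [|apply (Hc L HL)| |apply (Hc L HL)];
    apply Rsum_list_le; intros v _; unfold Cnorm2; nra.
Qed.

(** * Finitely supported vectors and density *)

Lemma Rsum_list_filter {V : Type} (P : V -> bool) (g : V -> R) L :
  Rsum_list (fun v => if P v then g v else 0) L = Rsum_list g (filter P L).
Proof.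
  induction L as [|a L IH]; simpl; auto. rewrite IH. destruct (P a); simpl; ring.
Qed.

Section Density.
Context {V : Type}.
Variable T : (V -> R) -> V -> R.
Variable x : V -> R.
Hypothesis Hbasis : forall v, in_cyclic_span T x (basis v).

Definition truncation (L : list V) (y : V -> R) : V -> R :=
  fun v => if excluded_middle_informative (In v L) then y v else 0.

Lemma l2_truncation (y : V -> R) d : l2 y -> 0 < d -> exists L, NoDup L /\
  norm_le (vdiff (truncation L y) y) d.
Proof.
  intros [r [Hr0 Hr]] Hd.
  set (E := fun s => exists L, NoDup L /\ s = Rsum_list (fun v => y v * y v) L).
  destruct (completeness E) as [S [HS1 HS2]].
  { exists (r * r). intros s (L & HL & ->). auto. }
  { exists 0, []; split; [constructor|reflexivity]. }
  (* If [L] comes within [d^2] of the supremum, any finite set disjoint from [L] carries at most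
     [d^2]. *)
  assert (HE : exists L, NoDup L /\ S - d * d < Rsum_list (fun v => y v * y v) L).
  { apply NNPP; intros Hn.
    assert (S <= S - d * d); [|nra]. apply HS2. intros s (L & HL & ->).
    destruct (Rle_dec (Rsum_list (fun v => y v * y v) L) (S - d * d)) as [|Hc]; auto.
    exfalso; apply Hn; exists L; split; auto; lra. }
  destruct HE as (L & HL & HLS). exists L; split; auto.
  split; [lra|]. intros L' HL'.
  set (P := fun v => if excluded_middle_informative (In v L) then false else true).
  rewrite (Rsum_list_ext _ (fun v => if P v then y v * y v else 0)).
  2:{ intros v _. unfold vdiff, truncation, P.
      destruct (excluded_middle_informative (In v L)); ring. }
  rewrite Rsum_list_filter.
  assert (Hdisj : NoDup (L ++ filter P L')).
  { apply NoDup_app; auto; [apply NoDup_filter; auto|].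
    intros v Hv Hv'. apply filter_In in Hv' as [_ Hv']. unfold P in Hv'.
    destruct (excluded_middle_informative (In v L)); [discriminate|contradiction]. }
  assert (Rsum_list (fun v => y v * y v) (L ++ filter P L') <= S).
  { apply HS1. eexists; split; [apply Hdisj|reflexivity]. }
  rewrite Rsum_list_app in H. lra.
Qed.

Lemma cyclic_span_dense y : l2 y -> in_cyclic_span T x y.
Proof.
  intros Hy. apply cyclic_span_closed; intros d Hd.
  destruct (l2_truncation y d Hy Hd) as (L & HL & Hn).
  eexists; split; [|apply Hn]. clear Hn.
  induction L as [|a L IH].
  - replace (truncation [] y) with (@vzero V); [apply cyclic_span_zero|].
    apply functional_extensionality; intros v. unfold truncation.
    destruct (excluded_middle_informative (In v [])); [contradiction|reflexivity].
  - inversion_clear HL as [|? ? Ha HL'].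
    replace (truncation (a :: L) y) with (vadd (vscal (y a) (basis a)) (truncation L y)).
    + apply cyclic_span_add; auto. apply cyclic_span_scal; auto.
    + apply functional_extensionality; intros v. unfold vadd, vscal, basis, truncation.
      destruct (excluded_middle_informative (v = a)) as [E|E],
        (excluded_middle_informative (In v L)) as [Hv|Hv],
        (excluded_middle_informative (In v (a :: L))) as [Hw|Hw]; simpl in Hw;
        try (exfalso; subst; intuition congruence); subst; ring.
Qed.

End Density.

(** The complex polynomial is [p + i q]. Its coefficients are chosen before [x], since the induction
    applies them to [T x]. *)
Lemma lincomb_cembed {V : Type} (TC : (V -> Defs.C) -> V -> Defs.C) (T : (V -> R) -> V -> R) :
  linear_contraction T -> (forall x, l2 x -> TC (cembed x) = cembed (T x)) ->
  forall p q, exists cs, forall x, l2 x ->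
    lincomb TC cs (cembed x) = fun v => (poly_app T p x v, poly_app T q x v).
Proof.
  intros HT HTC p; induction p as [|c p IH]; intros q.
  - induction q as [|d q [cs Hcs]].
    + exists []; intros x _; reflexivity.
    + exists ((0, d) :: cs); intros x Hx; simpl.
      rewrite HTC, Hcs by auto using op_l2.
      apply functional_extensionality; intros v.
      unfold Cadd, Cmul, cembed, vadd, vscal; simpl. unfold vzero. f_equal; ring.
  - destruct q as [|d q].
    + destruct (IH []) as [cs Hcs]. exists ((c, 0) :: cs); intros x Hx; simpl.
      rewrite HTC, Hcs by auto using op_l2.
      apply functional_extensionality; intros v.
      unfold Cadd, Cmul, cembed, vadd, vscal; simpl. unfold vzero. f_equal; ring.
    + destruct (IH q) as [cs Hcs]. exists ((c, d) :: cs); intros x Hx; simpl.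
      rewrite HTC, Hcs by auto using op_l2.
      apply functional_extensionality; intros v.
      unfold Cadd, Cmul, cembed, vadd, vscal; simpl. f_equal; ring.
Qed.

Lemma cyclic_of_real {V : Type} (TC : (V -> Defs.C) -> V -> Defs.C) (T : (V -> R) -> V -> R) x :
  linear_contraction T -> (forall y, l2 y -> TC (cembed y) = cembed (T y)) ->
  l2 x -> (forall v, in_cyclic_span T x (basis v)) -> cyclic TC.
Proof.
  intros HT HTC Hx Hb. exists (cembed x); split.
  { destruct Hx as [r Hr]. exists (r * r). apply norm2_le_cembed; auto. }
  intros y Hy eps He. destruct (l2_parts y Hy) as [Hy1 Hy2].
  (* The two parts contribute [2 d^2 <= d <= eps / 2], strictly below [eps]. *)
  set (d := Rmin 1 eps / 2).
  assert (Hd : 0 < d <= 1 / 2 /\ d <= eps / 2).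
  { unfold d. pose proof (Rmin_l 1 eps). pose proof (Rmin_r 1 eps).
    pose proof (Rmin_glb_lt 1 eps 0). lra. }
  destruct (cyclic_span_dense T x Hb _ Hy1 d) as [p [_ Hp]]; [lra|].
  destruct (cyclic_span_dense T x Hb _ Hy2 d) as [q [_ Hq]]; [lra|].
  destruct (lincomb_cembed TC T HT HTC p q) as [cs Hcs].
  exists cs, (d * d + d * d); split; [nra|].
  intros L HL. rewrite (Hcs x Hx).
  specialize (Hp L HL). specialize (Hq L HL).
  eapply Rle_trans; [|apply (Rplus_le_compat _ _ _ _ Hp Hq)].
  rewrite <- Rsum_list_plus. apply Rsum_list_le; intros v _.
  unfold vsub, Cnorm2, Cadd, Copp, vdiff; simpl. lra.
Qed.

(** * The adjoint of the weighted shift *)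

Section Adjoint.
Context {V : Type}.
Variables (par : V -> option V) (lam : V -> R).

Definition real_sum_children (u : V) (g : V -> R) (s : R) : Prop :=
  forall eps, 0 < eps -> exists L0, child_list par u L0 /\
    forall L, child_list par u L -> incl L0 L -> Rabs (Rsum_list g L - s) < eps.

Definition real_adj (x : V -> R) : V -> R := fun u =>
  epsilon (inhabits 0) (real_sum_children u (fun v => lam v * x v)).

Lemma child_list_union u L1 L2 : child_list par u L1 -> child_list par u L2 ->
  exists L, child_list par u L /\ incl L1 L /\ incl L2 L.
Proof.
  intros [_ H1] [_ H2].
  set (dec := fun a b : V => excluded_middle_informative (a = b)).
  exists (nodup dec (L1 ++ L2)); repeat split.
  - apply NoDup_nodup.
  - intros v Hv. apply nodup_In, in_app_or in Hv. destruct Hv; auto.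
  - intros v Hv. apply nodup_In, in_or_app; auto.
  - intros v Hv. apply nodup_In, in_or_app; auto.
Qed.

Lemma real_sum_children_unique u g s s' :
  real_sum_children u g s -> real_sum_children u g s' -> s = s'.
Proof.
  intros H H'. apply cond_eq; intros eps He.
  destruct (H (eps / 2)) as (L0 & HL0 & K0); [lra|].
  destruct (H' (eps / 2)) as (L1 & HL1 & K1); [lra|].
  destruct (child_list_union u L0 L1 HL0 HL1) as (L & HL & I0 & I1).
  specialize (K0 L HL I0). specialize (K1 L HL I1).
  apply Rabs_def2 in K0; apply Rabs_def2 in K1. apply Rabs_def1; lra.
Qed.

Lemma real_sum_children_axpy u a g h s s' :
  real_sum_children u g s -> real_sum_children u h s' ->
  real_sum_children u (fun v => a * g v + h v) (a * s + s').
Proof.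
  intros H H' eps He. pose proof (Rabs_pos a) as Ha.
  destruct (H (eps / 2 / (Rabs a + 1))) as (L0 & HL0 & K0);
    [apply Rdiv_lt_0_compat; lra|].
  destruct (H' (eps / 2)) as (L1 & HL1 & K1); [lra|].
  destruct (child_list_union u L0 L1 HL0 HL1) as (L2 & HL2 & I0 & I1).
  exists L2; split; auto. intros L HL HI.
  specialize (K0 L HL (incl_tran I0 HI)). specialize (K1 L HL (incl_tran I1 HI)).
  rewrite Rsum_list_plus, Rsum_list_scal.
  replace (a * Rsum_list g L + Rsum_list h L - (a * s + s'))
    with (a * (Rsum_list g L - s) + (Rsum_list h L - s')) by ring.
  eapply Rle_lt_trans; [apply Rabs_triang|]. rewrite Rabs_mult.
  assert (Rabs a * Rabs (Rsum_list g L - s) <= eps / 2); [|lra].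
  apply Rle_trans with ((Rabs a + 1) * (eps / 2 / (Rabs a + 1))).
  - apply Rmult_le_compat; try apply Rabs_pos; lra.
  - apply Req_le; field; lra.
Qed.

Lemma real_sum_children_single u v0 g : par v0 = Some u ->
  (forall v, par v = Some u -> v <> v0 -> g v = 0) -> real_sum_children u g (g v0).
Proof.
  intros Hv0 Hg eps He. exists [v0]; split.
  - split; [repeat constructor; auto|]. intros v [<-|[]]; auto.
  - intros L [HL1 HL2] HI. rewrite (Rsum_list_single _ L v0); auto.
    + unfold Rminus; rewrite Rplus_opp_r, Rabs_R0; auto.
    + apply HI; simpl; auto.
Qed.

Lemma real_sum_children_zero u g :
  (forall v, par v = Some u -> g v = 0) -> real_sum_children u g 0.
Proof.
  intros Hg eps He. exists []; split.
  - split; [constructor|]. intros v [].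
  - intros L [HL1 HL2] _. rewrite Rsum_list_zero by auto.
    rewrite Rminus_0_r, Rabs_R0; auto.
Qed.

Lemma real_sum_children_nonneg u g B : (forall v, 0 <= g v) ->
  (forall L, child_list par u L -> Rsum_list g L <= B) ->
  exists s, real_sum_children u g s.
Proof.
  intros Hg HB.
  set (E := fun s => exists L, child_list par u L /\ s = Rsum_list g L).
  destruct (completeness E) as [S [HS1 HS2]].
  { exists B. intros s (L & HL & ->). auto. }
  { exists 0, []; split; [|reflexivity]. split; [constructor|intros v []]. }
  exists S. intros eps He.
  assert (HE : exists L, child_list par u L /\ S - eps < Rsum_list g L).
  { apply NNPP; intros Hn.
    assert (S <= S - eps); [|lra]. apply HS2. intros s (L & HL & ->).
    destruct (Rle_dec (Rsum_list g L) (S - eps)) as [|Hc]; auto.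
    exfalso; apply Hn; exists L; split; auto; lra. }
  destruct HE as (L0 & HL0 & HS). exists L0; split; auto.
  intros L HL HI.
  assert (Rsum_list g L <= S) by (apply HS1; exists L; auto).
  assert (Rsum_list g L0 <= Rsum_list g L)
    by (apply Rsum_list_incl_le; auto; [apply HL0|apply HL]).
  apply Rabs_def1; lra.
Qed.

(** Write [g] as [(|g| + g) - |g|], a difference of nonnegative families whose sums are suprema. *)
Lemma real_sum_children_exists u g B :
  (forall L, child_list par u L -> Rsum_list (fun v => Rabs (g v)) L <= B) ->
  exists s, real_sum_children u g s.
Proof.
  intros HB.
  destruct (real_sum_children_nonneg u (fun v => Rabs (g v)) B) as [s1 H1]; auto.
  { intros; apply Rabs_pos. }
  destruct (real_sum_children_nonneg u (fun v => Rabs (g v) + g v) (2 * B)) as [s2 H2].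
  { intros v; pose proof (Rle_abs (- g v)) as E; rewrite Rabs_Ropp in E; lra. }
  { intros L HL. apply Rle_trans with (Rsum_list (fun v => 2 * Rabs (g v)) L).
    - apply Rsum_list_le; intros v _. pose proof (Rle_abs (g v)); lra.
    - rewrite Rsum_list_scal. specialize (HB L HL). lra. }
  exists (-1 * s1 + s2).
  pose proof (real_sum_children_axpy u (-1) _ _ _ _ H1 H2) as H.
  intros eps He. destruct (H eps He) as (L0 & HL0 & K). exists L0; split; auto.
  intros L HL HI. specialize (K L HL HI).
  rewrite (Rsum_list_ext g (fun v => -1 * Rabs (g v) + (Rabs (g v) + g v))); auto.
  intros; ring.
Qed.

Lemma real_adj_unique x u s :
  real_sum_children u (fun v => lam v * x v) s -> real_adj x u = s.
Proof.
  intros H. eapply real_sum_children_unique; [|apply H].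
  unfold real_adj. apply epsilon_spec. exists s; auto.
Qed.

Lemma real_adj_basis v : real_adj (basis v) =
  match par v with Some u => vscal (lam v) (basis u) | None => vzero end.
Proof.
  apply functional_extensionality; intros w. apply real_adj_unique.
  assert (Hz : par v <> Some w -> real_sum_children w (fun t => lam t * basis v t) 0).
  { intros Hvw. apply real_sum_children_zero. intros t Ht.
    rewrite basis_other by congruence. ring. }
  destruct (par v) as [u|] eqn:Ev; [|apply Hz; congruence].
  unfold vscal. destruct (classic (w = u)) as [->|Hw].
  - rewrite basis_same. rewrite <- (basis_same v).
    apply (real_sum_children_single u v (fun t => lam t * basis v t)); auto.
    intros t _ Ht. rewrite basis_other by auto. ring.
  - rewrite basis_other, Rmult_0_r by auto. apply Hz; congruence.
Qed.

Hypothesis Hcontr : contractive (wshift par lam).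

(** Contractivity is applied to the basis vector at [u]. *)
Lemma weights_sum_le1 u L : child_list par u L -> Rsum_list (fun v => lam v * lam v) L <= 1.
Proof.
  intros [HL1 HL2].
  pose proof (norm2_le_cembed _ _ (norm_le_basis u)) as Hn.
  specialize (Hcontr (cembed (basis u)) (1 * 1) (ex_intro _ _ Hn) Hn L HL1).
  rewrite Rmult_1_l in Hcontr. eapply Rle_trans; [|apply Hcontr].
  apply Rsum_list_le; intros v Hv. unfold wshift. rewrite (HL2 v Hv).
  unfold Cscale, Cnorm2, cembed; simpl. rewrite basis_same. lra.
Qed.

Lemma weight_sum_abs_le x r u L : norm_le x r -> child_list par u L ->
  Rsum_list (fun v => Rabs (lam v * x v)) L <= r.
Proof.
  intros [Hr0 Hr] HL.
  rewrite (Rsum_list_ext _ (fun v => Rabs (lam v) * Rabs (x v)))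
    by (intros; apply Rabs_mult).
  pose proof (Cauchy_Schwarz_list (fun v => Rabs (lam v)) (fun v => Rabs (x v)) L) as HC.
  assert (Habs : forall f : V -> R, Rsum_list (fun v => Rabs (f v) * Rabs (f v)) L
             = Rsum_list (fun v => f v * f v) L).
  { intros f. apply Rsum_list_ext; intros v _.
    rewrite <- Rabs_mult. apply Rabs_pos_eq, Rle_0_sqr. }
  cbv beta in HC. rewrite (Habs lam), (Habs x) in HC.
  pose proof (weights_sum_le1 u L HL) as H1. specialize (Hr L (proj1 HL)).
  assert (0 <= Rsum_list (fun v => lam v * lam v) L)
    by (apply Rsum_list_nonneg; intros; apply Rle_0_sqr).
  assert (0 <= Rsum_list (fun v => x v * x v) L)
    by (apply Rsum_list_nonneg; intros; apply Rle_0_sqr).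
  apply Rsqr_incr_0_var; auto. unfold Rsqr. nra.
Qed.

Lemma real_adj_spec x u : l2 x ->
  real_sum_children u (fun v => lam v * x v) (real_adj x u).
Proof.
  intros [r Hr]. unfold real_adj. apply epsilon_spec.
  apply real_sum_children_exists with r.
  intros L HL. apply (weight_sum_abs_le x r u); auto.
Qed.

(** Cauchy-Schwarz against weights of square sum at most 1, stated with a finite list of children so
    that the norm bound can be assembled from finite sums. *)
Lemma real_adj_coord x u eps : l2 x -> 0 < eps -> exists L, child_list par u L /\
  real_adj x u * real_adj x u <= Rsum_list (fun v => x v * x v) L + eps.
Proof.
  intros Hx He. pose proof (real_adj_spec x u Hx) as Hs.
  set (s := real_adj x u) in *.
  (* If the finite sum [q] is within [e] of [s], then [s^2 - q^2 <= 2 |s| |q - s| <= eps]. *)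
  set (e := Rmin 1 (eps / (2 * Rabs s + 1))).
  pose proof (Rabs_pos s) as Hs0.
  assert (Hq : 0 < eps / (2 * Rabs s + 1)) by (apply Rdiv_lt_0_compat; lra).
  assert (He0 : 0 < e) by (apply Rmin_glb_lt; lra).
  assert (He1 : e * (2 * Rabs s + 1) <= eps).
  { apply Rle_trans with (eps / (2 * Rabs s + 1) * (2 * Rabs s + 1)).
    - apply Rmult_le_compat_r; [lra|apply Rmin_r].
    - apply Req_le; field; lra. }
  destruct (Hs e He0) as (L & HL & K). exists L; split; auto.
  specialize (K L HL (incl_refl L)).
  set (q := Rsum_list (fun v => lam v * x v) L) in *.
  assert (Hq2 : q * q <= Rsum_list (fun v => x v * x v) L).
  { pose proof (Cauchy_Schwarz_list lam x L) as HC. fold q in HC.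
    pose proof (weights_sum_le1 u L HL).
    assert (0 <= Rsum_list (fun v => x v * x v) L)
      by (apply Rsum_list_nonneg; intros; apply Rle_0_sqr).
    nra. }
  assert (Hsq : s * s - q * q <= eps).
  { apply Rle_trans with (2 * (Rabs s * Rabs (q - s))).
    - assert (s * (s - q) <= Rabs s * Rabs (q - s)).
      { rewrite <- (Rabs_Ropp (q - s)), <- Rabs_mult.
        replace (- (q - s)) with (s - q) by ring. apply Rle_abs. }
      pose proof (Rle_0_sqr (s - q)) as Hsqr; unfold Rsqr in Hsqr. nra.
    - pose proof (Rabs_pos (q - s)). nra. }
  lra.
Qed.

(** Distinct vertices have disjoint sets of children, so the coordinate estimates add up to a single
    finite sum of squares of [x]. *)
Lemma real_adj_norm x r : norm_le x r -> norm_le (real_adj x) r.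
Proof.
  intros Hr. assert (Hx : l2 x) by (exists r; auto).
  split; [apply (norm_le_nonneg _ _ Hr)|]. intros us Hus.
  assert (Hap : forall eps, 0 < eps -> exists L, NoDup L /\
    (forall v, In v L -> exists u, In u us /\ par v = Some u) /\
    Rsum_list (fun u => real_adj x u * real_adj x u) us
      <= Rsum_list (fun v => x v * x v) L + eps).
  { induction us as [|u us IH]; intros eps He.
    - exists []; simpl; repeat split; [constructor|intros v []|lra].
    - inversion_clear Hus as [|? ? Hu Hus'].
      destruct (IH Hus' (eps / 2)) as (L1 & HL1 & HP1 & HS1); [lra|].
      destruct (real_adj_coord x u (eps / 2) Hx) as (L2 & [HL2 HP2] & HS2); [lra|].
      exists (L2 ++ L1); repeat split.
      + apply NoDup_app; auto. intros v H2 H1.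
        destruct (HP1 v H1) as (u' & Hu' & E). rewrite (HP2 v H2) in E.
        injection E as ->; contradiction.
      + intros v Hv; apply in_app_or in Hv as [Hv|Hv].
        * exists u; simpl; auto.
        * destruct (HP1 v Hv) as (u' & ? & ?). exists u'; simpl; auto.
      + rewrite Rsum_list_app; simpl. lra. }
  apply Rle_plus_epsilon; intros eps He.
  destruct (Hap eps He) as (L & HL & _ & HS).
  pose proof (proj2 Hr L HL). lra.
Qed.

Lemma real_adj_contraction : linear_contraction real_adj.
Proof.
  split; [|apply real_adj_norm].
  intros a x y Hx Hy. apply functional_extensionality; intros u.
  apply real_adj_unique.
  pose proof (real_sum_children_axpy u a _ _ _ _ (real_adj_spec x u Hx)
                (real_adj_spec y u Hy)) as H.
  replace (fun v => lam v * vadd (vscal a x) y v)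
    with (fun v => a * (lam v * x v) + lam v * y v); auto.
  vext.
Qed.

Lemma Csum_list_cembed (g : V -> R) L :
  Csum_list (fun v => (g v, 0)) L = (Rsum_list g L, 0).
Proof.
  induction L as [|a L IH]; simpl; auto. rewrite IH. unfold Cadd; simpl.
  rewrite Rplus_0_r; auto.
Qed.

Lemma wshift_adj_cembed x : l2 x ->
  wshift_adj par lam (cembed x) = cembed (real_adj x).
Proof.
  intros Hx. apply functional_extensionality; intros u.
  pose proof (real_adj_spec x u Hx) as Hs. unfold wshift_adj.
  replace (fun v => Cscale (lam v) (cembed x v))
    with (fun v => (lam v * x v, 0)).
  2:{ apply functional_extensionality; intros v.
      unfold Cscale, cembed; simpl. rewrite Rmult_0_r; auto. }
  set (P := fun s => has_sum_children par u (fun v => (lam v * x v, 0)) s).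
  assert (HP : P (cembed (real_adj x) u)).
  { intros eps He.
    destruct (Hs (sqrt eps)) as (L0 & HL0 & K); [apply sqrt_lt_R0; auto|].
    exists L0; split; auto. intros L HL HI. specialize (K L HL HI).
    rewrite Csum_list_cembed. unfold cembed, Cadd, Copp, Cnorm2; simpl.
    set (q := Rsum_list (fun v => lam v * x v) L) in *.
    fold (Rminus q (real_adj x u)).
    rewrite <- (sqrt_sqrt eps) by lra.
    apply Rabs_def2 in K. nra. }
  pose proof (epsilon_spec (inhabits C0) P (ex_intro _ _ HP)) as HE.
  set (s := epsilon (inhabits C0) P) in *. fold P.
  change (s = cembed (real_adj x) u).
  set (s' := cembed (real_adj x) u) in *. clearbody s s'.
  (* Uniqueness of the complex sum, by [|s - s'|^2 <= 2 |q - s|^2 + 2 |q - s'|^2] for a common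
     finite sum [q]. *)
  assert (Hd : (fst s - fst s') * (fst s - fst s') + (snd s - snd s') * (snd s - snd s') <= 0).
  { apply Rle_plus_epsilon; intros eps He. rewrite Rplus_0_l.
    destruct (HP (eps / 4)) as (L0 & HL0 & K0); [lra|].
    destruct (HE (eps / 4)) as (L1 & HL1 & K1); [lra|].
    destruct (child_list_union u L0 L1 HL0 HL1) as (L & HL & I0 & I1).
    specialize (K0 L HL I0). specialize (K1 L HL I1).
    unfold Cnorm2, Cadd, Copp in K0, K1; simpl in K0, K1.
    set (q := Csum_list (fun v => (lam v * x v, 0)) L) in *. clearbody q.
    pose proof (Rle_0_sqr ((fst q - fst s) + (fst q - fst s'))) as S1.
    pose proof (Rle_0_sqr ((snd q - snd s) + (snd q - snd s'))) as S2.
    unfold Rsqr in S1, S2. nra. }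
  pose proof (Rle_0_sqr (fst s - fst s')) as S1.
  pose proof (Rle_0_sqr (snd s - snd s')) as S2.
  apply injective_projections; apply Rminus_diag_uniq, Rsqr_0_uniq; unfold Rsqr in *; lra.
Qed.

End Adjoint.

(** * Countability of the tree *)

(** Iterated unpairing, which enumerates the lists of each fixed length. *)
Fixpoint decode_list (fuel n : nat) : list nat :=
  match fuel with
  | O => []
  | S k => fst (of_nat n) :: decode_list k (snd (of_nat n))
  end.

Lemma decode_list_surj l : exists n, decode_list (length l) n = l.
Proof.
  induction l as [|a l [n Hn]]; [exists O; auto|].
  exists (to_nat (a, n)). cbn [length decode_list]. rewrite cancel_of_to; simpl.
  rewrite Hn; auto.
Qed.

(** A list of elements of [P] is extended as long as it misses one; the bound stops this before
    length [N + 1]. *)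
Lemma bounded_NoDup_cover {V : Type} (P : V -> Prop) N :
  (forall L, NoDup L -> (forall v, In v L -> P v) -> (length L <= N)%nat) ->
  exists L, forall v, P v -> In v L.
Proof.
  intros H.
  assert (Hk : forall k, (exists L, forall v, P v -> In v L) \/
    exists L, NoDup L /\ (forall v, In v L -> P v) /\ length L = k).
  { induction k as [|k [IH|(L & H1 & H2 & H3)]]; auto.
    - right; exists []; repeat split; [constructor|intros v []].
    - destruct (classic (forall v, P v -> In v L)) as [Hc|Hc]; [left; eauto|].
      apply not_all_ex_not in Hc as [v Hv]. apply imply_to_and in Hv as [Hv1 Hv2].
      right; exists (v :: L); repeat split; [constructor; auto| |simpl; auto].
      intros w [<-|Hw]; auto. }
  destruct (Hk (S N)) as [|(L & H1 & H2 & H3)]; auto.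
  specialize (H L H1 H2). lia.
Qed.

Section Tree.
Context {V : Type}.
Variables (par : V -> option V) (lam : V -> R).
Hypothesis Htree : is_directed_tree par.
Hypothesis Hpos : forall v, par v <> None -> 0 < lam v.
Hypothesis Hcontr : contractive (wshift par lam).
Hypothesis HC1 : class_C1dot (wshift par lam).

(** At most [n] children can have squared weight at least [1/n], since the squared weights sum to at
    most 1. Positivity of the weights makes these sets exhaust the children. *)
Lemma heavy_children_finite u n :
  exists L, forall v, par v = Some u /\ 1 <= INR n * (lam v * lam v) -> In v L.
Proof.
  apply bounded_NoDup_cover with n. intros L HL HP.
  apply INR_le.
  pose proof (weights_sum_le1 par lam Hcontr u L
    (conj HL (fun v Hv => proj1 (HP v Hv)))) as H1.
  assert (H2 : INR (length L) <= INR n * Rsum_list (fun v => lam v * lam v) L).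
  { clear H1 HL. induction L as [|a L IH]; [simpl; lra|].
    cbn [length]. rewrite S_INR; simpl.
    specialize (IH (fun v Hv => HP v (or_intror Hv))).
    pose proof (proj2 (HP a (or_introl eq_refl))). lra. }
  pose proof (pos_INR n). nra.
Qed.

Lemma children_enumerable : exists c : V -> nat -> V,
  forall u v, par v = Some u -> exists n, c u n = v.
Proof.
  set (Lst := fun u n => proj1_sig
    (constructive_indefinite_description _ (heavy_children_finite u n))).
  exists (fun u k => nth (snd (of_nat k)) (Lst u (fst (of_nat k))) u).
  intros u v Huv.
  assert (Hl : 0 < lam v) by (apply Hpos; congruence).
  destruct (nfloor_ex (/ (lam v * lam v))) as [n Hn].
  { apply Rlt_le, Rinv_0_lt_compat; nra. }
  assert (Hin : In v (Lst u (S n))).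
  { unfold Lst.
    apply (proj2_sig (constructive_indefinite_description _ (heavy_children_finite u (S n)))).
    split; auto. rewrite S_INR.
    assert (Hll : 0 < lam v * lam v) by nra.
    apply Rle_trans with (/ (lam v * lam v) * (lam v * lam v)); [rewrite Rinv_l; lra|].
    apply Rmult_le_compat_r; lra. }
  destruct (In_nth _ _ u Hin) as (i & _ & Hi).
  exists (to_nat (S n, i)). rewrite cancel_of_to; simpl; auto.
Qed.

Lemma vertices_enumerable (o : V) : exists e : nat -> V, forall v, exists n, e n = v.
Proof.
  destruct children_enumerable as [c Hc].
  (* Walks are coded by words: [0] moves to the parent and [n + 1] to the [n]-th child.
     Connectedness lets such walks reach every vertex from [o]. *)
  set (step := fun u k => match k with
    | O => match par u with Some w => w | None => u end
    | S n => c u n end).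
  assert (Hreach : forall u v, clos_refl_sym_trans V (edge par) u v ->
    (exists l, fold_left step l u = v) /\ (exists l, fold_left step l v = u)).
  { intros u v H.
    induction H as [u v H|u|u v H [IH1 IH2]
      |u v w H1 [[l1 E1] [k1 F1]] H2 [[l2 E2] [k2 F2]]].
    - split.
      + destruct (Hc u v H) as [n Hn]. exists [S n]; auto.
      + exists [O]; simpl. unfold edge in H; rewrite H; auto.
    - split; exists []; auto.
    - split; auto.
    - split; [exists (l1 ++ l2)|exists (k2 ++ k1)]; rewrite fold_left_app; congruence. }
  exists (fun n => fold_left step (decode_list (fst (of_nat n)) (snd (of_nat n))) o).
  intros v. destruct (Hreach o v (proj2 Htree o v)) as [[l Hl] _].
  destruct (decode_list_surj l) as [m Hm].
  exists (to_nat (length l, m)). rewrite cancel_of_to; simpl. rewrite Hm; auto.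
Qed.

(** * Ancestors and the normalising potential *)

Lemma anc_add m n v :
  anc par (m + n) v = match anc par m v with Some w => anc par n w | None => None end.
Proof.
  induction n as [|n IH].
  - rewrite Nat.add_0_r; simpl. destruct (anc par m v); auto.
  - rewrite Nat.add_succ_r; simpl. rewrite IH. destruct (anc par m v); auto.
Qed.

Lemma anc_succ_l n v u : par v = Some u -> anc par (S n) v = anc par n u.
Proof.
  intros H. change (S n) with (1 + n)%nat. rewrite anc_add; simpl. rewrite H; auto.
Qed.

Lemma anc_acyclic m n v w : anc par m v = Some w -> anc par n v = Some w -> m = n.
Proof.
  assert (Hlt : forall m n, (m < n)%nat -> anc par m v = Some w -> anc par n v <> Some w).
  { intros m' n' Hl Hm Hn. replace n' with (m' + S (n' - m' - 1))%nat in Hn by lia.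
    rewrite anc_add, Hm in Hn. exact (proj1 Htree _ _ Hn). }
  intros Hm Hn. destruct (Nat.lt_trichotomy m n) as [H|[H|H]]; auto.
  - exfalso; exact (Hlt m n H Hm Hn).
  - exfalso; exact (Hlt n m H Hn Hm).
Qed.

(** In the transitive case both meeting points are ancestors of the middle vertex, hence lie on one
    chain, and the higher one serves. *)
Lemma common_ancestor u v :
  exists m n w, anc par m u = Some w /\ anc par n v = Some w.
Proof.
  pose proof (proj2 Htree u v) as H.
  induction H as [u v H|u|u v H (m & n & w & H1 & H2)
    |u v t _ (m & n & w & H1 & H2) _ (n' & k & w' & H3 & H4)].
  - exists O, 1%nat, u; simpl; auto.
  - exists O, O, u; auto.
  - exists n, m, w; auto.
  - destruct (Nat.le_gt_cases n n') as [Hn|Hn].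
    + exists (m + (n' - n))%nat, k, w'. split; auto.
      rewrite anc_add, H1. replace n' with (n + (n' - n))%nat in H3 by lia.
      rewrite anc_add, H2 in H3; auto.
    + exists m, (k + (n - n'))%nat, w. split; auto.
      rewrite anc_add, H4. replace n with (n' + (n - n'))%nat in H2 by lia.
      rewrite anc_add, H3 in H2; auto.
Qed.

(** The product of the weights on the [m] edges leading up from [v]. *)
Fixpoint wprod (m : nat) (v : V) : R :=
  match m with
  | O => 1
  | S k => wprod k v * match anc par k v with Some w => lam w | None => 1 end
  end.

Lemma wprod_add m n v w : anc par m v = Some w ->
  wprod (m + n) v = wprod m v * wprod n w.
Proof.
  intros H; induction n as [|n IH].
  - rewrite Nat.add_0_r; simpl; ring.
  - rewrite Nat.add_succ_r; simpl. rewrite IH, anc_add, H. ring.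
Qed.

Lemma wprod_pos m v w : anc par m v = Some w -> 0 < wprod m v.
Proof.
  revert w; induction m as [|m IH]; intros w Hw; simpl in *; [lra|].
  destruct (anc par m v) as [t|] eqn:E; [|discriminate].
  apply Rmult_lt_0_compat; [eapply IH; eauto|]. apply Hpos; congruence.
Qed.

(** The second meeting point lies above the first, so both paths acquire the same further edges and
    the same further factor. *)
Lemma meeting_compare o v m n m' n' w w' :
  anc par m v = Some w -> anc par n o = Some w ->
  anc par m' v = Some w' -> anc par n' o = Some w' -> (m <= m')%nat ->
  (m' + n = m + n')%nat /\ wprod n o * wprod m' v = wprod n' o * wprod m v.
Proof.
  intros H1 H2 H3 H4 Hm.
  replace m' with (m + (m' - m))%nat in H3 by lia. rewrite anc_add, H1 in H3.
  assert (H5 : anc par (n + (m' - m)) o = Some w') by (rewrite anc_add, H2; auto).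
  pose proof (anc_acyclic _ _ _ _ H4 H5) as E. split; [lia|].
  rewrite E. replace m' with (m + (m' - m))%nat at 1 by lia.
  rewrite (wprod_add n _ o w H2), (wprod_add m _ v w H1). ring.
Qed.

(* [gam] conjugates the shift to the unweighted one, [lev] is the generation. *)
Lemma tree_potential (o : V) : exists (gam : V -> R) (lev : V -> Z),
  (forall v, 0 < gam v) /\ gam o = 1 /\ lev o = 0%Z /\
  forall v u, par v = Some u -> gam v * lam v = gam u /\ (lev v = lev u + 1)%Z.
Proof.
  set (meet := fun v (q : nat * nat) =>
    exists w, anc par (fst q) v = Some w /\ anc par (snd q) o = Some w).
  assert (Hex : forall v, exists q, meet v q).
  { intros v. destruct (common_ancestor v o) as (m & n & w & H1 & H2).
    exists (m, n), w; auto. }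
  set (q := fun v => proj1_sig (constructive_indefinite_description _ (Hex v))).
  assert (Hq : forall v, meet v (q v))
    by (intros v; exact (proj2_sig (constructive_indefinite_description _ (Hex v)))).
  clearbody q.
  set (gam := fun v => wprod (snd (q v)) o / wprod (fst (q v)) v).
  set (lev := fun v => (Z.of_nat (fst (q v)) - Z.of_nat (snd (q v)))%Z).
  (* The values are independent of the chosen meeting point, so a vertex and its parent can be
     compared at the same one. *)
  assert (Hind : forall v m n w, anc par m v = Some w -> anc par n o = Some w ->
    gam v = wprod n o / wprod m v /\ lev v = (Z.of_nat m - Z.of_nat n)%Z).
  { intros v m n w H1 H2. destruct (Hq v) as (w' & H3 & H4).
    unfold gam, lev. set (m' := fst (q v)) in *. set (n' := snd (q v)) in *.
    pose proof (wprod_pos _ _ _ H1). pose proof (wprod_pos _ _ _ H3).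
    assert (E : (m' + n = m + n')%nat /\ wprod n o * wprod m' v = wprod n' o * wprod m v).
    { destruct (Nat.le_gt_cases m m') as [Hm|Hm].
      - eapply meeting_compare; eauto.
      - destruct (meeting_compare o v m' n' m n w' w H3 H4 H1 H2) as [E1 E2]; [lia|].
        split; [lia|auto]. }
    destruct E as [E1 E2]. split; [|lia].
    apply (Rmult_eq_reg_r (wprod m v * wprod m' v)); [|nra].
    transitivity (wprod n' o * wprod m v); [field; lra|]. rewrite <- E2. field; lra. }
  exists gam, lev. split; [|split; [|split]].
  - intros v. destruct (Hq v) as (w & H1 & H2).
    apply Rdiv_lt_0_compat; eapply wprod_pos; eauto.
  - destruct (Hind o O O o) as [E _]; auto. rewrite E; simpl; field.
  - destruct (Hind o O O o) as [_ E]; auto.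
  - intros v u Huv. destruct (Hq u) as (w & H1 & H2).
    destruct (Hind u _ _ w H1 H2) as [E1 E2].
    destruct (Hind v (S (fst (q u))) (snd (q u)) w) as [E3 E4]; auto.
    { rewrite (anc_succ_l _ v u); auto. }
    rewrite E1, E2, E3, E4. split; [|lia].
    change (S (fst (q u))) with (1 + fst (q u))%nat.
    rewrite (wprod_add 1 _ v u Huv). simpl.
    pose proof (wprod_pos _ _ _ H1). assert (0 < lam v) by (apply Hpos; congruence).
    field; lra.
Qed.

Lemma cembed_basis_nonzero (o : V) : exists v, cembed (basis o) v <> C0.
Proof.
  exists o. unfold cembed, C0. rewrite basis_same. intros E; injection E; lra.
Qed.

(** The shift would kill the basis vector at a leaf, against class [C_1.]. *)
Lemma leafless v : exists w, par w = Some v.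
Proof.
  apply NNPP; intros Hn.
  assert (Hz : forall n, Nat.iter (S n) (wshift par lam) (cembed (basis v)) = fun _ => C0).
  { induction n as [|n IH].
    - apply functional_extensionality; intros w. simpl. unfold wshift.
      destruct (par w) as [u|] eqn:E; auto.
      unfold cembed. rewrite basis_other by (intros ->; apply Hn; eauto).
      unfold Cscale, C0; simpl. f_equal; ring.
    - cbn [Nat.iter nat_rect] in *. rewrite IH.
      apply functional_extensionality; intros w. unfold wshift.
      destruct (par w); auto. unfold Cscale, C0; simpl. f_equal; ring. }
  apply (HC1 (cembed (basis v))).
  - eexists; apply norm2_le_cembed, norm_le_basis.
  - apply cembed_basis_nonzero.
  - intros eps He; exists 1%nat; intros [|n] Hle; [lia|].
    rewrite Hz. intros L HL. rewrite Rsum_list_zero; [lra|].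
    intros; unfold Cnorm2, C0; simpl; ring.
Qed.

Lemma lam_le1 v u : par v = Some u -> lam v <= 1.
Proof.
  intros Hv. assert (Hl : 0 < lam v) by (apply Hpos; congruence).
  assert (Hc : child_list par u [v]).
  { split; [repeat constructor; auto|]. intros w [<-|[]]; auto. }
  pose proof (weights_sum_le1 par lam Hcontr u [v] Hc) as H. simpl in H. nra.
Qed.

(** * The rooted case *)

Lemma scaled_basis_op (gam : V -> R) v :
  (forall v u, par v = Some u -> gam v * lam v = gam u) ->
  real_adj par lam (vscal (gam v) (basis v)) =
  match par v with Some u => vscal (gam u) (basis u) | None => vzero end.
Proof.
  intros Hg.
  rewrite (op_scal _ (real_adj_contraction par lam Hcontr)), real_adj_basis
    by (eexists; apply norm_le_basis).
  destruct (par v) as [u|] eqn:E; [|vext].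
  rewrite <- (Hg v u E). vext.
Qed.

Lemma iter_forest (T : (V -> R) -> V -> R) (kap : V -> V -> R) m v :
  T vzero = vzero ->
  (forall v, T (kap v) = match par v with Some u => kap u | None => vzero end) ->
  Nat.iter m T (kap v) = match anc par m v with Some w => kap w | None => vzero end.
Proof.
  intros H0 HT. induction m as [|m IH]; auto. simpl. rewrite IH.
  destruct (anc par m v); auto.
Qed.

Lemma rooted_cyclic : has_root par -> cyclic (wshift_adj par lam).
Proof.
  intros [r Hr].
  pose proof (real_adj_contraction par lam Hcontr) as HT.
  destruct (tree_potential r) as (gam & lev & Hg0 & _ & _ & Hg).
  destruct (vertices_enumerable r) as [e He].
  set (kap := fun v => vscal (gam v) (basis v)).
  assert (Hkop : forall v, real_adj par lam (kap v) =
            match par v with Some u => kap u | None => vzero end).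
  { intros v; apply scaled_basis_op. intros; apply Hg; auto. }
  destruct (cyclic_span_nilpotent_extension (real_adj par lam) HT par kap e vzero)
    as (x & Hx & _ & Hk); auto using l2_zero, leafless.
  - intros v. apply l2_scal. eexists; apply norm_le_basis.
  - intros v. destruct (common_ancestor v r) as (m & n & w & H1 & H2).
    exists (S m). rewrite (iter_forest _ kap) by (auto using op_zero).
    (* The root has no proper ancestor, so the meeting point is the root itself and one more step
       kills the vector. *)
    assert (Hn : n = O).
    { destruct n as [|n]; auto. change (S n) with (1 + n)%nat in H2.
      rewrite anc_add in H2; simpl in H2. rewrite Hr in H2; discriminate. }
    subst n. simpl in H2. injection H2 as <-. simpl. rewrite H1, Hr; auto.
  - intros d Hd. exists []. replace (poly_app _ _ _) with (@vzero V) by (simpl; vext).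
    eapply norm_le_weaken; [apply norm_le_zero|lra].
  - apply (cyclic_of_real _ (real_adj par lam) x); auto.
    + intros y Hy. apply wshift_adj_cembed; auto.
    + intros v. replace (basis v) with (vscal (/ gam v) (kap v)).
      * apply cyclic_span_scal; auto.
      * specialize (Hg0 v). unfold kap; vext. field. lra.
Qed.

(** * The rootless case *)

Definition branching (u : V) : Prop :=
  exists a b, a <> b /\ par a = Some u /\ par b = Some u.

(** Otherwise every vertex has a branching descendant, possibly itself, and descending repeatedly
    yields [N + 1] distinct branching vertices, each adding 1 to the branching sum. *)
Lemma eventually_unbranched : V -> Br_finite par ->
  exists o, forall n v, anc par n v = Some o -> ~ branching v.
Proof.
  intros v0 [N HN]. apply NNPP; intros Hno.
  assert (Hbr : forall o, exists n v, anc par n v = Some o /\ branching v).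
  { intros o. apply NNPP; intros Hc. apply Hno. exists o. intros n v Hv Hb.
    apply Hc; eauto. }
  assert (Hk : forall k, exists us o, NoDup us /\ length us = k /\
    forall u, In u us -> branching u /\ exists n, anc par (S n) o = Some u).
  { induction k as [|k (us & o & H1 & H2 & H3)].
    - exists [], v0; repeat split; [constructor| |]; intros; contradiction.
    - destruct (Hbr o) as (n & v & Hv & a & b & Hab & Ha & Hb).
      (* Moving on to a child [a] of [v] makes all vertices collected so far proper ancestors of the
         new base point. *)
      exists (v :: us), a; split; [|split; [simpl; auto|]].
      + constructor; auto. intros Hin. destruct (H3 v Hin) as [_ [m Hm]].
        apply (proj1 Htree (n + m)%nat v). rewrite <- Nat.add_succ_r, anc_add, Hv; auto.
      + intros u [<-|Hu].
        * split; [exists a, b; auto|]. exists O; auto.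
        * destruct (H3 u Hu) as [Hbu [m Hm]]. split; auto.
          exists (n + S m)%nat. rewrite (anc_succ_l _ a v) by auto.
          rewrite anc_add, Hv; auto. }
  destruct (Hk (S N)) as (us & o & H1 & H2 & H3).
  set (f := fun u => epsilon (inhabits []) (fun l => length l = 2%nat /\ child_list par u l)).
  assert (Hf : forall u, branching u -> length (f u) = 2%nat /\ child_list par u (f u)).
  { intros u (a & b & Hab & Ha & Hb). unfold f. apply epsilon_spec.
    exists [a; b]; split; auto. split.
    - repeat constructor; simpl; intuition.
    - intros w [<-|[<-|[]]]; auto. }
  specialize (HN us f H1 (fun u Hu => proj2 (Hf u (proj1 (H3 u Hu))))).
  assert (Hs : fold_right (fun u acc => (length (f u) - 1) + acc)%nat O us = length us).
  { clear HN H1 H2. induction us as [|u us IH]; simpl; auto.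
    rewrite (proj1 (Hf u (proj1 (H3 u (or_introl eq_refl))))), IH; auto.
    intros w Hw; apply H3; right; auto. }
  rewrite Hs in HN. lia.
Qed.

(** * The two-sided path through an unbranched vertex *)

Section Path.
Variables (up down : V -> V) (o : V) (gam : V -> R) (lev : V -> Z).
Hypothesis Hup : forall v, par v = Some (up v).
Hypothesis Hdown : forall v, par (down v) = Some v.
Hypothesis Hunbr : forall n v, anc par n v = Some o -> ~ branching v.
Hypothesis Hgam : forall v, 0 < gam v.
Hypothesis Hgam_o : gam o = 1.
Hypothesis Hlev_o : lev o = 0%Z.
Hypothesis Hpot : forall v u, par v = Some u -> gam v * lam v = gam u /\ (lev v = lev u + 1)%Z.

Definition point (k : Z) : V :=
  if Z_le_dec 0 k then Nat.iter (Z.to_nat k) down o else Nat.iter (Z.to_nat (- k)) up o.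

Lemma point_par k : par (point (k + 1)) = Some (point k).
Proof.
  unfold point. destruct (Z_le_dec 0 k) as [Hk|Hk].
  - destruct (Z_le_dec 0 (k + 1)); [|lia].
    replace (Z.to_nat (k + 1)) with (S (Z.to_nat k)) by lia. apply Hdown.
  - replace (Z.to_nat (- k)) with (S (Z.to_nat (- (k + 1)))) by lia.
    destruct (Z_le_dec 0 (k + 1)) as [H1|H1].
    + replace (Z.to_nat (- (k + 1))) with O by lia.
      replace (Z.to_nat (k + 1)) with O by lia. apply Hup.
    + apply Hup.
Qed.

Lemma point_down n : point (Z.of_nat n) = Nat.iter n down o.
Proof.
  unfold point. destruct (Z_le_dec 0 (Z.of_nat n)); [|lia]. rewrite Nat2Z.id; auto.
Qed.

Lemma point_0 : point 0 = o.
Proof. exact (point_down 0). Qed.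

Lemma anc_point_down n : anc par n (point (Z.of_nat n)) = Some o.
Proof.
  rewrite point_down. induction n as [|n IH]; auto.
  rewrite (anc_succ_l n _ (Nat.iter n down o)); auto. apply Hdown.
Qed.

Lemma point_anc n : anc par n o = Some (point (- Z.of_nat n)).
Proof.
  induction n as [|n IH]; simpl.
  - rewrite point_0; auto.
  - rewrite IH. rewrite <- point_par. f_equal. f_equal. lia.
Qed.

Lemma point_lev k : lev (point k) = k.
Proof.
  assert (Hstep : forall k, lev (point (k + 1)) = (lev (point k) + 1)%Z)
    by (intros; apply Hpot, point_par).
  assert (H0 : lev (point 0) = 0%Z) by (rewrite point_0; auto).
  assert (Hp : forall n : nat, lev (point (Z.of_nat n)) = Z.of_nat n /\
                         lev (point (- Z.of_nat n)) = (- Z.of_nat n)%Z).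
  { induction n as [|n [IH1 IH2]]; [auto|]. split.
    - replace (Z.of_nat (S n)) with (Z.of_nat n + 1)%Z by lia. rewrite Hstep; lia.
    - specialize (Hstep (- Z.of_nat (S n))%Z).
      replace (- Z.of_nat (S n) + 1)%Z with (- Z.of_nat n)%Z in Hstep by lia. lia. }
  destruct (Z.le_gt_cases 0 k) as [Hk|Hk].
  - replace k with (Z.of_nat (Z.to_nat k)) by lia. apply Hp.
  - replace k with (- Z.of_nat (Z.to_nat (- k)))%Z by lia. apply Hp.
Qed.

Lemma gam_mono v u : par v = Some u -> gam u <= gam v.
Proof.
  intros Hv. rewrite <- (proj1 (Hpot v u Hv)).
  pose proof (lam_le1 v u Hv). pose proof (Hgam v). nra.
Qed.

Lemma gam_point_mono k n : gam (point k) <= gam (point (k + Z.of_nat n)).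
Proof.
  induction n as [|n IH]; [rewrite Z.add_0_r; lra|].
  eapply Rle_trans; [apply IH|]. apply gam_mono.
  replace (k + Z.of_nat (S n))%Z with (k + Z.of_nat n + 1)%Z by lia. apply point_par.
Qed.

(** No vertex from [o] downwards branches, so the orbit of its basis vector stays on the path. *)
Lemma wshift_orbit n : Nat.iter n (wshift par lam) (cembed (basis o)) =
  cembed (vscal (/ gam (point (Z.of_nat n))) (basis (point (Z.of_nat n)))).
Proof.
  induction n as [|n IH].
  - simpl. rewrite point_0, Hgam_o. f_equal. vext. field.
  - simpl Nat.iter. rewrite IH.
    replace (Z.of_nat (S n)) with (Z.of_nat n + 1)%Z by lia.
    set (k := Z.of_nat n). pose proof (point_par k) as Hpk.
    destruct (Hpot _ _ Hpk) as [Hg _].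
    pose proof (Hgam (point k)). pose proof (Hgam (point (k + 1))).
    assert (Hl : 0 < lam (point (k + 1))) by (apply Hpos; congruence).
    apply functional_extensionality; intros v. unfold wshift, cembed, vscal.
    destruct (classic (v = point (k + 1))) as [->|Hv].
    + rewrite Hpk, !basis_same. unfold Cscale; simpl. rewrite <- Hg. f_equal; field; lra.
    + rewrite (basis_other (point (k + 1))) by auto.
      destruct (par v) as [u|] eqn:E; [|unfold C0; f_equal; ring].
      assert (Hu : u <> point k).
      { intros ->. apply (Hunbr n (point k)).
        - apply anc_point_down.
        - exists v, (point (k + 1)); auto. }
      rewrite basis_other by auto. unfold Cscale; simpl. f_equal; ring.
Qed.

(** [gam] is monotone along the path, so if it were unbounded the orbit of the basis vector at [o]
    would tend to 0, against class [C_1.]. Monotonicity also settles negative [k]. *)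
Lemma gam_point_bounded : exists K, 0 < K /\ forall k, gam (point k) <= K.
Proof.
  assert (Hb : exists K, 0 < K /\ forall n : nat, gam (point (Z.of_nat n)) <= K).
  { apply NNPP; intros Hn.
    apply (HC1 (cembed (basis o))).
    - eexists; apply norm2_le_cembed, norm_le_basis.
    - apply cembed_basis_nonzero.
    - intros eps He.
      assert (Hs : 0 < sqrt eps) by (apply sqrt_lt_R0; auto).
      assert (HN : exists N : nat, / sqrt eps < gam (point (Z.of_nat N))).
      { apply NNPP; intros Hc. apply Hn. exists (/ sqrt eps).
        split; [apply Rinv_0_lt_compat; auto|]. intros n.
        destruct (Rle_dec (gam (point (Z.of_nat n))) (/ sqrt eps)); auto.
        exfalso; apply Hc; exists n; lra. }
      destruct HN as [N HN]. exists N; intros n Hle.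
      rewrite wshift_orbit. rewrite <- (sqrt_sqrt eps) by lra.
      apply norm2_le_cembed.
      eapply norm_le_weaken; [apply norm_le_scal, norm_le_basis|].
      pose proof (gam_point_mono (Z.of_nat N) (n - N)) as Hm.
      replace (Z.of_nat N + Z.of_nat (n - N))%Z with (Z.of_nat n) in Hm by lia.
      rewrite Rmult_1_r, Rabs_pos_eq by (apply Rlt_le, Rinv_0_lt_compat, Hgam).
      rewrite <- (Rinv_inv (sqrt eps)).
      apply Rinv_le_contravar; [apply Rinv_0_lt_compat; auto|lra]. }
  destruct Hb as (K & HK & Hb). exists K; split; auto. intros k.
  destruct (Z.le_gt_cases 0 k) as [Hk|Hk].
  - replace k with (Z.of_nat (Z.to_nat k)) by lia. auto.
  - eapply Rle_trans; [apply (gam_point_mono k (Z.to_nat (- k)))|].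
    replace (k + Z.of_nat (Z.to_nat (- k)))%Z with (Z.of_nat 0) by lia. auto.
Qed.

(** The map sending [e_k] to [gam e] at [point k]; [v = point (lev v)] tests whether [v] is on the
    path. *)
Definition path_embed (b : Z -> R) : V -> R := fun v =>
  if excluded_middle_informative (v = point (lev v)) then gam v * b (lev v) else 0.

Lemma path_embed_point b k : path_embed b (point k) = gam (point k) * b k.
Proof.
  unfold path_embed. rewrite point_lev.
  destruct (excluded_middle_informative (point k = point k)); tauto.
Qed.

Lemma path_embed_off b v : v <> point (lev v) -> path_embed b v = 0.
Proof.
  intros H. unfold path_embed.
  destruct (excluded_middle_informative (v = point (lev v))); tauto.
Qed.

Lemma path_embed_lin a b c :
  path_embed (vadd (vscal a b) c) = vadd (vscal a (path_embed b)) (path_embed c).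
Proof.
  apply functional_extensionality; intros v. unfold path_embed, vadd, vscal.
  destruct (excluded_middle_informative (v = point (lev v))); ring.
Qed.

Lemma path_embed_norm K b r : (forall k, gam (point k) <= K) ->
  norm_le b r -> norm_le (path_embed b) (K * r).
Proof.
  intros HK [Hr0 Hr].
  assert (HK0 : 0 < K) by (eapply Rlt_le_trans; [apply Hgam|apply (HK 0%Z)]).
  split; [nra|]. intros L HL.
  assert (HZ : exists Lz, NoDup Lz /\ (forall k, In k Lz -> In (point k) L) /\
    Rsum_list (fun v => path_embed b v * path_embed b v) L
      <= K * K * Rsum_list (fun k => b k * b k) Lz).
  { induction L as [|a L IH].
    - exists []; simpl; repeat split; [constructor|auto|lra].
    - inversion_clear HL as [|? ? Ha HL'].
      destruct (IH HL') as (Lz & H1 & H2 & H3).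
      destruct (classic (a = point (lev a))) as [E|E].
      + exists (lev a :: Lz); split; [|split].
        * constructor; auto. intros Hin. apply H2 in Hin. rewrite <- E in Hin; auto.
        * intros k [<-|Hk]; [left; auto|right; auto].
        * simpl. rewrite E at 1 2. rewrite path_embed_point, <- E.
          assert (Hg : gam a * gam a <= K * K).
          { pose proof (Hgam a). specialize (HK (lev a)). rewrite <- E in HK. nra. }
          pose proof (Rle_0_sqr (b (lev a))) as Hb; unfold Rsqr in Hb. nra.
      + exists Lz; split; [auto|split].
        * intros k Hk; right; auto.
        * simpl. rewrite path_embed_off by auto. lra. }
  destruct HZ as (Lz & H1 & _ & H3). specialize (Hr Lz H1). nra.
Qed.

Lemma path_embed_bshift b :
  real_adj par lam (path_embed b) = path_embed (bshift b).
Proof.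
  apply functional_extensionality; intros u. apply real_adj_unique.
  destruct (classic (u = point (lev u))) as [E|E].
  - rewrite E. set (k := lev u). rewrite path_embed_point. unfold bshift.
    pose proof (point_par k) as Hpk. destruct (Hpot _ _ Hpk) as [Hg _].
    replace (gam (point k) * b (k + 1)%Z)
      with (lam (point (k + 1)) * path_embed b (point (k + 1)))
      by (rewrite path_embed_point, <- Hg; ring).
    apply (real_sum_children_single par (point k) (point (k + 1))
             (fun v => lam v * path_embed b v)); auto.
    (* The path has one vertex per generation, so a second child of [point k] is off it. Off the
       path no child is on it, as parents of path points are path points. *)
    intros v Hv Hne. rewrite path_embed_off; [ring|]. intros Ev. apply Hne.
    rewrite Ev. f_equal. destruct (Hpot _ _ Hv) as [_ ->]. rewrite point_lev; auto.
  - rewrite path_embed_off by auto. apply real_sum_children_zero.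
    intros v Hv. rewrite path_embed_off; [ring|]. intros Ev. apply E.
    destruct (Hpot _ _ Hv) as [_ El]. rewrite El, Ev in *.
    pose proof (point_par (lev u)) as Hpk. congruence.
Qed.

Lemma path_embed_basis k :
  path_embed (basis k) = vscal (gam (point k)) (basis (point k)).
Proof.
  apply functional_extensionality; intros v. unfold vscal.
  destruct (classic (v = point (lev v))) as [E|E].
  - rewrite E, path_embed_point. set (j := lev v).
    destruct (Z.eq_dec j k) as [->|Hj].
    + rewrite !basis_same; auto.
    + rewrite !basis_other; auto; [ring|]. intros Ej. apply Hj.
      rewrite <- (point_lev j), Ej, point_lev; auto.
  - rewrite path_embed_off by auto. rewrite basis_other; [ring|].
    intros ->. apply E. rewrite point_lev; auto.
Qed.

Lemma path_cyclic : cyclic (wshift_adj par lam).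
Proof.
  pose proof (real_adj_contraction par lam Hcontr) as HT.
  set (T := real_adj par lam) in *.
  destruct gam_point_bounded as (K & HK0 & HK).
  destruct (vertices_enumerable o) as [e He].
  set (eh := fun v => vscal (gam v) (basis v)).
  set (kap := fun v => vdiff (eh v) (eh (point (lev v)))).
  assert (Heh : forall v, l2 (eh v))
    by (intros v; apply l2_scal; eexists; apply norm_le_basis).
  assert (Heop : forall v, T (eh v) = eh (up v)).
  { intros v. unfold T, eh. rewrite scaled_basis_op, Hup; auto.
    intros; apply Hpot; auto. }
  assert (Hkop : forall v, T (kap v) = match par v with Some u => kap u | None => vzero end).
  { intros v. unfold kap. rewrite (op_diff T HT), !Heop, Hup by auto.
    f_equal. f_equal. destruct (Hpot _ _ (Hup v)) as [_ El].
    pose proof (point_par (lev (up v))) as Hpk. rewrite <- El, Hup in Hpk. congruence. }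
  assert (Jn : forall b r, norm_le b r -> norm_le (path_embed b) (K * r))
    by (intros; apply path_embed_norm; auto).
  destruct (cyclic_span_nilpotent_extension T HT par kap e (path_embed cyc_seq))
    as (x & Hx & Hf & Hk); auto using leafless.
  - intros v; apply l2_diff; auto.
  - intros v. destruct (common_ancestor v o) as (m & n & w & H1 & H2).
    (* The [m]-th ancestor is also an ancestor of [o], hence on the path, where the two terms of
       [kap] cancel. *)
    exists m. rewrite (iter_forest T kap) by (auto using op_zero). rewrite H1.
    rewrite point_anc in H2. injection H2 as <-. unfold kap. rewrite point_lev. vext.
  - apply (embed_l2 path_embed K Jn), cyc_seq_l2.
  - intros d Hd. apply (embed_null T path_embed K path_embed_lin Jn path_embed_bshift); lra.
  - assert (Hpt : forall k, in_cyclic_span T x (eh (point k))).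
    { intros k. unfold eh. rewrite <- path_embed_basis.
      apply (embed_basis_in_span T HT path_embed K path_embed_lin Jn path_embed_bshift);
        auto; lra. }
    apply (cyclic_of_real _ T x); auto.
    + intros y Hy. apply wshift_adj_cembed; auto.
    + intros v. replace (basis v) with
        (vscal (/ gam v) (vadd (kap v) (eh (point (lev v))))).
      * apply cyclic_span_scal, cyclic_span_add; auto.
      * pose proof (Hgam v). unfold kap. vext. unfold eh, vscal. field. lra.
Qed.

End Path.

Lemma rootless_cyclic : ~ has_root par -> Br_finite par -> cyclic (wshift_adj par lam).
Proof.
  intros Hnr HBr.
  destruct (classic (exists v0 : V, True)) as [[v0 _]|Hempty].
  - destruct (eventually_unbranched v0 HBr) as [o Ho].
    assert (Hup : forall v, exists u, par v = Some u).
    { intros v. destruct (par v) as [u|] eqn:E; [eauto|]. exfalso; apply Hnr; exists v; auto. }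
    set (up := fun v => proj1_sig (constructive_indefinite_description _ (Hup v))).
    set (down := fun v => proj1_sig (constructive_indefinite_description _ (leafless v))).
    destruct (tree_potential o) as (gam & lev & H1 & H2 & H3 & H4).
    apply (path_cyclic up down o gam lev); auto.
    + intros v; exact (proj2_sig (constructive_indefinite_description _ (Hup v))).
    + intros v; exact (proj2_sig (constructive_indefinite_description _ (leafless v))).
  (* On an empty vertex set the zero vector is cyclic. *)
  - assert (Hall : forall L : list V, L = []).
    { intros [|v L]; auto. exfalso; apply Hempty; eauto. }
    exists (fun _ => C0); split.
    + exists 0. intros L _. rewrite (Hall L); simpl; lra.
    + intros y _ eps He. exists [], 0; split; auto.
      intros L _. rewrite (Hall L); simpl; lra.
Qed.

End Tree.

Theorem mainTheorem18 (V : Type) (par : V -> option V) (lam : V -> R)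
  (Htree : is_directed_tree par)
  (Hw : admissible_weights par lam)
  (Hcontr : contractive (wshift par lam))
  (HC1 : class_C1dot (wshift par lam)) :
  (has_root par -> cyclic (wshift_adj par lam)) /\
  (~ has_root par -> Br_finite par -> cyclic (wshift_adj par lam)).
Proof.
  split.
  - apply rooted_cyclic; auto. apply Hw.
  - apply rootless_cyclic; auto. apply Hw.
Qed.
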